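(* (First Weierstrass–Erdmann condition.) Let $t_0<t_1$, $0<\alpha\le 1$, $\beta>0$, $x_0,x_1\in\mathbb{R}^n$, and let $L=L(t,x,y)$ be a real function of $2n+1$ variables ($t\in\mathbb{R}$, $x,y\in\mathbb{R}^n$). Consider the problem (P): extremize $$J(x(\cdot))=\int_{t_0}^{t_1}(t_1-t)^{\beta-1}L\big(t,x(t),({}^{c}D^{\alpha}_{t_0+}x)(t)\big)\,dt,\qquad x(t_0)=x_0,\quad x(t_1)=x_1,$$ over $x\in PC^{\alpha}([t_0,t_1],\mathbb{R}^n)$. Suppose that $x^0$ provides a weak local extremum in (P) and that $L,L_x,L_y$ are continuous in some neighborhood of the graph $\{(t,x^0(t),({}^{c}D^{\alpha}_{t_0+}x^0)(t)) : t\in[t_0,t_1]\}$. Then at each corner point $t\in A$ of $x^0$, $$L_y\big(t,x^0(t),({}^{c}D^{\alpha}_{t_0+}x^0)(t-0)\big)=L_y\big(t,x^0(t),({}^{c}D^{\alpha}_{t_0+}x^0)(t+0)\big).$$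
   Context: $PC([t_0,t_1],\mathbb{R}^n)$ is the set of piecewise continuous functions: continuous on $[t_0,t_1]$ except at finitely many points of $(t_0,t_1)$, where they have discontinuities of the first kind (finite one-sided limits). For $\alpha>0$: $(I^{\alpha}_{t_0+}\varphi)(t)=\frac{1}{\Gamma(\alpha)}\int_{t_0}^{t}(t-\tau)^{\alpha-1}\varphi(\tau)\,d\tau$. For $0<\alpha<1$ and continuous $\varphi$: $({}^{c}D^{\alpha}_{t_0+}\varphi)(t)=\frac{d}{dt}\big(I^{1-\alpha}_{t_0+}(\varphi(\cdot)-\varphi(t_0))\big)(t)$; for $\alpha=1$ it is the ordinary derivative. $PC^{\alpha}([t_0,t_1],\mathbb{R}^n)$ is the set of all continuous $\varphi$ with $\varphi(t)=\varphi(t_0)+(I^{\alpha}_{t_0+}\psi)(t)$ on $[t_0,t_1]$ for some $\psi\in PC([t_0,t_1],\mathbb{R}^n)$; then ${}^{c}D^{\alpha}_{t_0+}\varphi=\psi$ at the continuity points of $\psi$. Norm: $\|y\|_{PC^{\alpha}}=\|y\|_{C}+\|{}^{c}D^{\alpha}_{t_0+}y\|_{L^{\infty}}$. A function $x\in PC^{\alpha}([t_0,t_1],\mathbb{R}^n)$ is admissible if $x(t_0)=x_0$, $x(t_1)=x_1$. An admissible $x^0$ delivers a weak local minimum (maximum) if there is $\delta>0$ such that $J(x(\cdot))\ge J(x^0(\cdot))$ (respectively $\le$) for every admissible $x$ with $\|x-x^0\|_{PC^{\alpha}}<\delta$; a weak local extremum is a weak local minimum or maximum. $A\subset(t_0,t_1)$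 is the set of discontinuity points (of the first kind) of ${}^{c}D^{\alpha}_{t_0+}x^0$; its elements are the corner points of $x^0$, and $(t\pm0)$ denotes one-sided limits. At $t\in A$ the graph is understood to contain both points $(t,x^0(t),({}^{c}D^{\alpha}_{t_0+}x^0)(t\pm0))$. $L_x,L_y$ denote the gradients in $x$ and $y$. *)

(* Defs.v *)
From HB Require Import structures.
From mathcomp Require Export all_boot all_order all_algebra.
From mathcomp Require Export all_classical all_reals all_analysis.

Set Implicit Arguments.
Unset Strict Implicit.
Unset Printing Implicit Defensive.

Import Order.TTheory GRing.Theory Num.Theory.
Import numFieldNormedType.Exports.

Local Open Scope classical_set_scope.
Local Open Scope ring_scope.

(* A function on [t0, t1] is a total function on R of which only the values
   on `[t0, t1] are ever used. *)

Section PiecewiseContinuous.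
Context {R : realType} {V : normedModType R}.
Implicit Types (t : R) (f : R -> V).

Definition first_kind_discontinuity f t : Prop :=
  [/\ cvg (f @ t^'-), cvg (f @ t^'+) & ~ {for t, continuous f}].

(* Continuity of f at t relative to [t0, t1]: one-sided at t0 and t1. *)
Definition continuous_at_in t0 t1 f t : Prop :=
  f @ within `[t0, t1] (nbhs t) --> f t.

Definition PC t0 t1 f : Prop :=
  exists S : seq R,
    [/\ forall s, s \in S -> t0 < s < t1,
        forall s, s \in S -> first_kind_discontinuity f s
      & forall t, t0 <= t <= t1 -> t \notin S -> continuous_at_in t0 t1 f t].

(* Derivative of f at t relative to [t0, t1]: one-sided at t0 and t1. *)
Definition derive_in t0 t1 f t : V :=
  lim ((fun s => (s - t)^-1 *: (f s - f t)) @ within `[t0, t1] t^').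

End PiecewiseContinuous.

Section FractionalCalculus.
Context {R : realType} {n : nat}.
Implicit Types (t alpha : R) (phi : R -> 'rV[R]_n).

Definition Gamma alpha : R :=
  \int[lebesgue_measure]_(t in `]0, +oo[) (t `^ (alpha - 1) * expR (- t)).

Definition frac_int t0 alpha phi t : 'rV[R]_n :=
  (Gamma alpha)^-1 *:
  \row_i \int[lebesgue_measure]_(tau in `[t0, t])
           ((t - tau) `^ (alpha - 1) * phi tau 0 i).

(* Intended for 0 < alpha <= 1. At points where the derivative does not exist
   (in particular at corner points) the value carries no meaning. *)
Definition caputo t0 t1 alpha phi : R -> 'rV[R]_n :=
  if alpha == 1 then derive_in t0 t1 phi
  else derive_in t0 t1 (frac_int t0 (1 - alpha) (fun tau => phi tau - phi t0)).

Definition PCalpha t0 t1 alpha phi : Prop :=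
  (forall t, t0 <= t <= t1 -> continuous_at_in t0 t1 phi t) /\
  exists psi : R -> 'rV[R]_n, PC t0 t1 psi /\
    forall t, t0 <= t <= t1 -> phi t = phi t0 + frac_int t0 alpha psi t.

(* The norm on R^n is the max norm of the library; another choice gives an
   equivalent norm, hence the same weak local extrema. *)
Definition C_norm t0 t1 phi : \bar R :=
  ereal_sup [set `|phi t|%:E | t in `[t0, t1]].

Definition Linfty_norm t0 t1 phi : \bar R :=
  'N[mrestr lebesgue_measure (measurable_itv `[t0, t1])]_+oo
    [ (fun t => `|phi t|%:E) ]%E.

Definition PCalpha_norm t0 t1 alpha phi : \bar R :=
  (C_norm t0 t1 phi + Linfty_norm t0 t1 (caputo t0 t1 alpha phi))%E.

Definition corner_points t0 t1 alpha phi : set R :=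
  [set t | t0 < t < t1 /\ first_kind_discontinuity (caputo t0 t1 alpha phi) t].

Definition graph_caputo t0 t1 alpha phi : set (R * 'rV[R]_n * 'rV[R]_n) :=
  let D := caputo t0 t1 alpha phi in
  let A := corner_points t0 t1 alpha phi in
  [set (t, phi t, D t) | t in `[t0, t1] `\` A] `|`
  ([set (t, phi t, lim (D @ t^'-)) | t in A] `|`
   [set (t, phi t, lim (D @ t^'+)) | t in A]).

End FractionalCalculus.

Section Integrand.
Context {R : realType} {n : nat}.
Implicit Types (L : R -> 'rV[R]_n -> 'rV[R]_n -> R) (x y : 'rV[R]_n).

Definition has_gradient (f : 'rV[R]_n -> R) x : Prop :=
  forall i, derivable f x (delta_mx 0 i).

Definition gradient (f : 'rV[R]_n -> R) x : 'rV[R]_n :=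
  \row_i 'D_(delta_mx 0 i) f x.

Definition grad_x L t x y : 'rV[R]_n := gradient (fun x' => L t x' y) x.

Definition grad_y L t x y : 'rV[R]_n := gradient (fun y' => L t x y') y.

Definition C1xy_near L (G : set (R * 'rV[R]_n * 'rV[R]_n)) : Prop :=
  exists U : set (R * 'rV[R]_n * 'rV[R]_n),
    [/\ open U, G `<=` U
      & forall t x y, U (t, x, y) ->
        [/\ has_gradient (fun x' => L t x' y) x,
            has_gradient (fun y' => L t x y') y,
            {for (t, x, y), continuous (fun p => L p.1.1 p.1.2 p.2)},
            {for (t, x, y), continuous (fun p => grad_x L p.1.1 p.1.2 p.2)}
          & {for (t, x, y), continuous (fun p => grad_y L p.1.1 p.1.2 p.2)}]].

End Integrand.

Section VariationalProblem.
Context {R : realType} {n : nat}.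
Variables (t0 t1 alpha beta : R) (a b : 'rV[R]_n).
Variable L : R -> 'rV[R]_n -> 'rV[R]_n -> R.
Implicit Types x : R -> 'rV[R]_n.

(* The integral is a total operation, whose value carries no meaning when the
   integrand is not integrable. This is harmless below: near the graph of a reference function
   where L is continuous the integral is finite, and the radius delta in the
   definition of an extremum may always be shrunk. *)
Definition functional x : R :=
  \int[lebesgue_measure]_(t in `[t0, t1])
    ((t1 - t) `^ (beta - 1) * L t (x t) (caputo t0 t1 alpha x t)).

Definition admissible x : Prop :=
  [/\ PCalpha t0 t1 alpha x, x t0 = a & x t1 = b].

Definition weak_local_min x : Prop :=
  admissible x /\ exists2 delta : R, 0 < delta &
    forall z, admissible z ->
      (PCalpha_norm t0 t1 alpha (z \- x)%R < delta%:E)%E ->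
      functional x <= functional z.

Definition weak_local_max x : Prop :=
  admissible x /\ exists2 delta : R, 0 < delta &
    forall z, admissible z ->
      (PCalpha_norm t0 t1 alpha (z \- x)%R < delta%:E)%E ->
      functional z <= functional x.

Definition weak_local_extremum x : Prop :=
  weak_local_min x \/ weak_local_max x.

End VariationalProblem.

(* Main.v *)
(* Needle variation. Perturb the density of x^0 near a corner tau, along one
   coordinate and with a small amplitude, by +1 on [tau - e, tau) and by -k on
   [tau, tau + e), where k = k(e) is chosen so that the fractional integral h
   of this needle vanishes at t1, and k(e) -> 1 as e -> 0. Although h does not
   vanish off the needle, |h| / e is dominated by a multiple of
   |t - tau|^(alpha-1), and it tends to 0, so h contributes only o(e) to the
   increment of J through L_x. Hence the increment is governed by e times the
   jump of L_y, and minimality along both signs of the perturbation makes the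
   jump vanish. A maximum is a minimum for -L.

   By Fubini, the Caputo derivative of phi(t0) + I^alpha psi is c psi at the
   continuity points of psi, for a constant c depending on alpha only. In fact
   c = 1, but this is not needed: if c = 0 then the Caputo derivative of x^0
   vanishes off a finite set and its one-sided limits agree. *)

Require Import Defs.
From mathcomp Require Import ring lra measurable_realfun.
Import Order.TTheory GRing.Theory Num.Theory.
Import numFieldNormedType.Exports.
Local Open Scope classical_set_scope.
Local Open Scope ring_scope.

Set Implicit Arguments.
Unset Strict Implicit.
Unset Printing Implicit Defensive.

(** Three small quantities occur: a tolerance e, the needle width d, the amplitude lam. The
    amplitude is chosen last, for a given needle, and only keeps the varied curve inside the weak
    neighborhood. The mean value theorem bounds the increment of J by an expression exactly
    proportional to lam, so lam cancels and J is never expanded in lam; only the width tends to 0.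
    The needle has two halves because the endpoint condition at t1 must survive: the fractional
    integral of one positive block stays positive to its right. Two obstacles shape the rest. For
    alpha < 1 the quotient h / d is not bounded near tau uniformly in d, and for beta < 1 the weight
    blows up at t1, so dominated convergence replaces uniform estimates. Moreover L is controlled
    only near a graph that jumps, so a uniform tube comes from compactness of [t0, t1] with separate
    conditions on the two sides of each point. Caputo derivatives are known only off finite sets,
    hence the exceptional sequences F carried throughout. *)

(** * The kernels (t - s)^(g-1) and Abel's identity *)

Section AffineSubstitution.
Context {R : realType}.
Notation mu := (@lebesgue_measure R).

Let affine (c d : R) : measurableTypeR R -> measurableTypeR R :=
  fun u => (c + d * u)%R.

Let measurable_affine c d : measurable_fun setT (affine c d).
Proof. by apply: measurable_funD => //; exact: measurable_funM. Qed.

(** The scaled pushforward gives []a, b]] its length, and Lebesgue measure is the only measure that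
    does. The pushforward is a witness because its measure structure contains the measurability of
    the map. *)
Lemma lebesgue_measure_affine (c d : R) : 0 < d ->
  exists nu : {measure set (measurableTypeR R) -> \bar R},
    nu = pushforward mu (affine c d) :> (set _ -> \bar R) /\
    forall A, measurable A -> mu A = (d%:E * nu A)%E.
Proof.
move=> d0.
have [nu nuE] : exists nu : {measure set (measurableTypeR R) -> \bar R},
    nu = pushforward mu (affine c d) :> (set _ -> \bar R).
  by eexists; reflexivity.
exists nu; split=> // A mA.
have d0' : 0 <= d by exact: ltW.
rewrite -[RHS]/(mscale (NngNum d0') nu A).
apply/lebesgue_measure_unique => //= _ [[a b]] _ <-.
rewrite /mscale nuE /pushforward /=.
have -> : affine c d @^-1` `]a, b] = `](a - c) / d, (b - c) / d]%classic.
  apply/seteqP; split=> u /=; rewrite !in_itv/= ltr_pdivrMr// ler_pdivlMr//;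
  by rewrite ltrBlDl lerBrDl mulrC.
rewrite !lebesgue_measure_itv/= !lte_fin.
rewrite ltr_pM2r ?invr_gt0// ltrD2r; case: ifP; rewrite ?mule0// => _.
by rewrite -!EFinB -EFinM -mulrBl mulrCA divff ?gt_eqF// mulr1 opprB addrA subrK.
Unshelve. all: exact: measurable_affine.
Qed.

Lemma ge0_integral_affine (c d : R) (f : R -> \bar R) : 0 < d ->
  measurable_fun setT f -> (forall x, 0 <= f x)%E ->
  (\int[mu]_x f x = d%:E * \int[mu]_u f (c + d * u)%R)%E.
Proof.
move=> d0 mf f0.
have [nu [nuE muE]] := lebesgue_measure_affine c d0.
have -> : (\int[mu]_u f (c + d * u)%R = \int[nu]_x f x)%E.
  rewrite nuE; apply/esym.
  by rewrite (@ge0_integral_pushforward _ _ _ _ _ _ (measurable_affine c d)).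
have d0' : 0 <= d by exact: ltW.
have -> : (d%:E * \int[nu]_x f x = \int[mscale (NngNum d0') nu]_x f x)%E.
  by rewrite ge0_integral_mscale.
apply: eq_measure_integral => A mA _; exact: muE.
Qed.

End AffineSubstitution.

Section PowerIntegrals.
Context {R : realType}.
Notation mu := (@lebesgue_measure R).
Implicit Types a b t g : R.

Lemma measurable_kernel t g (D : set R) :
  measurable_fun D (fun s => (t - s) `^ g).
Proof.
apply: measurable_funTS; apply: (measurableT_comp (measurable_powR _)).
exact: measurable_funB.
Qed.

Lemma continuous_kernel t g s : s < t ->
  {for s, continuous (fun s : R => (t - s) `^ g)}.
Proof.
move=> st; have ts0 : 0 < t - s by rewrite subr_gt0.
apply: (@continuous_comp _ _ _ (fun s : R => t - s) (fun x : R => x `^ g)).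
  by apply: cvgB; [exact: cvg_cst|exact: cvg_id].
apply: differentiable_continuous; apply/derivable1_diffP.
by have [] := is_derive1_powR g ts0.
Qed.

Lemma integral_kernel_lt t g a b : 0 < g -> a < b -> b < t ->
  (\int[mu]_(s in `[a, b]) ((t - s) `^ (g - 1))%:E =
   (((t - a) `^ g - (t - b) `^ g) / g)%:E)%E.
Proof.
move=> g0 ab bt.
have dF s : s < t -> is_derive s 1 (fun s => - ((t - s) `^ g / g)) ((t - s) `^ (g - 1)).
  move=> st; have ts0 : 0 < t - s by rewrite subr_gt0.
  have d1 : is_derive s 1 (fun s => t - s) (-1).
    by apply: is_derive_eq; ring.
  have := @is_derive1_comp R (fun x => x `^ g) (fun s => t - s) s _ _ (is_derive1_powR g ts0) d1.
  move=> d2.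
  have -> : (fun s => - ((t - s) `^ g / g)) =
      - g^-1 \*: ((fun x => x `^ g) \o (fun s => t - s)).
    by apply/funext => u /=; rewrite scaleNr mulrC.
  by apply: is_derive_eq; rewrite /GRing.scale/=; field; lra.
have cF s : s < t -> {for s, continuous (fun s => - ((t - s) `^ g / g))}.
  move=> st; apply: differentiable_continuous; apply/derivable1_diffP.
  by have [] := dF _ st.
rewrite (@continuous_FTC2 _ _ (fun s => - ((t - s) `^ g / g))) //.
- by rewrite -EFinB; congr EFin; field; lra.
- apply: continuous_in_subspaceT => s; rewrite inE/= in_itv/= => /andP[_ sb].
  have st : s < t by lra.
  exact: (@continuous_kernel t (g - 1) s).
- split.
  + move=> s; rewrite in_itv/= => /andP[_ sb].
    have [] // : is_derive s 1 (fun s => - ((t - s) `^ g / g)) ((t - s) `^ (g - 1)).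
    by apply: dF; lra.
  + by apply: cvg_at_right_filter; apply: cF; lra.
  + by apply: cvg_at_left_filter; apply: cF; lra.
- move=> s; rewrite in_itv/= => /andP[_ sb].
  by rewrite derive1E; apply: derive_val; apply: dF; lra.
Qed.

(** For g < 1 the kernel is unbounded at t, so the fundamental theorem is applied on shorter
    intervals and monotone convergence adds the rest. *)
Lemma integral_kernel t g a : 0 < g -> a <= t ->
  (\int[mu]_(s in `[a, t]) ((t - s) `^ (g - 1))%:E = ((t - a) `^ g / g)%:E)%E.
Proof.
move=> g0; rewrite le_eqVlt => /predU1P[->|at_].
  by rewrite set_itv1 integral_set1 subrr powR0 ?gt_eqF// mul0r.
have d0 : 0 < t - a by rewrite subr_gt0.
(* The shift by 2 makes [e n < t - a] strict already at n = 0, so every truncated interval is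
   nondegenerate. *)
pose e n := (t - a) * n.+2%:R^-1.
have e0 n : 0 < e n by rewrite mulr_gt0.
have ed n : e n < t - a by rewrite ltr_pdivrMr// ltr_pMr// ltr1n.
have cvge : e n @[n --> \oo] --> (0 : R).
  rewrite -(mulr0 (t - a)); apply: cvgMr.
  by rewrite (cvg_shiftS (@harmonic R)); exact: cvg_harmonic.
have cvgeg : (e n) `^ g @[n --> \oo] --> (0 : R).
  by have /cvg_at_rightP := powR_cvg0 g0; apply; split.
have mK D := @measurable_kernel t (g - 1) D.
rewrite -integral_itv_bndo_bndc; last exact/measurable_EFinP.
have -> : `[a, t[%classic = \bigcup_n `[a, t - e n]%classic.
  apply/seteqP; split=> s /=.
    rewrite in_itv/= => /andP[as_ st].
    have /cvgrPdist_lt/(_ (t - s)) := cvge; rewrite subr_gt0 => /(_ st)[N _ /(_ N)]/=.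
    rewrite leqnn sub0r normrN gtr0_norm// => /(_ isT) eN.
    by exists N => //=; rewrite in_itv/=; lra.
  by case=> n _ /=; rewrite !in_itv/=; have := e0 n; lra.
set F := fun n => `[a, (t - e n)%R]%classic.
pose f s := ((t - s) `^ (g - 1))%:E.
have cvgI : (\int[mu]_(s in F n) f s)%E @[n --> \oo] --> (\int[mu]_(s in \bigcup_n F n) f s)%E.
  apply: ge0_nondecreasing_set_cvg_integral => //.
  - apply/nondecreasing_seqP => n; apply/subsetPset => s; rewrite /F/= !in_itv/=.
    have : e n.+1 <= e n.
      by rewrite ler_pM2l// lef_pV2 ?posrE// ler_nat.
    lra.
  - by move=> n; exact: measurable_itv.
  - by move=> n; apply/measurable_EFinP; exact: mK.
  - by move=> n s _; rewrite lee_fin powR_ge0.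
rewrite -(cvg_lim _ cvgI)//; apply/cvg_lim => //.
have -> : (fun n => \int[mu]_(s in F n) f s)%E =
    (fun n => (((t - a) `^ g - (e n) `^ g) / g)%:E).
  apply/funext => n; rewrite integral_kernel_lt//; last 2 first.
  - by have := ed n; lra.
  - by have := e0 n; lra.
  by rewrite subKr.
apply: cvg_EFin; first exact: nearW.
rewrite -[X in _ --> X / g]subr0; apply: cvgMl; apply: cvgB => //; exact: cvg_cst.
Qed.

Lemma integrable_kernel t g a : 0 < g -> a <= t ->
  mu.-integrable `[a, t] (fun s => ((t - s) `^ (g - 1))%:E).
Proof.
move=> g0 at_; apply/integrableP; split.
  by apply/measurable_EFinP; exact: measurable_kernel.
under eq_integral do rewrite gee0_abs ?lee_fin ?powR_ge0//.
by rewrite integral_kernel// ltry.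
Qed.

End PowerIntegrals.

Section AbelKernel.
Context {R : realType}.
Notation mu := (@lebesgue_measure R).
Implicit Types (a r s t g M : R).
Variable al : R.
Hypothesis al01 : 0 < al < 1.

(** Euler's beta integral B(al, 1 - al), extended real until [abel_beta_lty] shows that it is
    finite. *)
Definition abel_beta : \bar R :=
  (\int[mu]_(u in `[0%R, 1%R]) ((1 - u) `^ (- al) * u `^ (al - 1))%:E)%E.

Lemma measurable_abel_kernel r t (D : set R) :
  measurable_fun D (fun s => (t - s) `^ (- al) * (s - r) `^ (al - 1)).
Proof.
apply: measurable_funM; first exact: measurable_kernel.
apply: measurable_funTS; apply: (measurableT_comp (measurable_powR _)).
exact: measurable_funB.
Qed.

(** Substitute s = r + (t - r) u: the exponents - al and al - 1 add up to -1, which cancels the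
    Jacobian t - r. Independence of r and t is what turns a double fractional integral into a plain
    one. *)
Lemma integral_abel_kernel r t : r < t ->
  (\int[mu]_(s in `[r, t]) ((t - s) `^ (- al) * (s - r) `^ (al - 1))%:E =
   abel_beta)%E.
Proof.
move=> rt; have d0 : 0 < t - r by rewrite subr_gt0.
rewrite integral_mkcond (ge0_integral_affine r d0); last 2 first.
- apply/measurable_restrict => //; apply: measurable_funTS.
  by apply/measurable_EFinP; exact: measurable_abel_kernel.
- by move=> s; apply: erestrict_ge0 => x _; rewrite lee_fin mulr_ge0// powR_ge0.
rewrite /abel_beta [in RHS]integral_mkcond.
set G := (fun u : R => ((1 - u) `^ (- al) * u `^ (al - 1))%:E) \_ `[0%R, 1%R].
transitivity ((t - r)%:E * \int[mu]_u (((t - r)^-1)%:E * G u))%E.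
  congr *%E; apply: eq_integral => u _; rewrite /G !patchE.
  have -> : (r + (t - r) * u \in `[r, t]%classic) = (u \in `[0, 1]%classic).
    rewrite !mem_setE !in_itv/=.
    by rewrite lerDl pmulr_rge0// -lerBrDl ger_pMr//.
  case: ifPn => [|]; last by rewrite mule0.
  rewrite mem_setE in_itv/= => /andP[u0 u1].
  rewrite -EFinM; congr EFin.
  have -> : t - (r + (t - r) * u) = (t - r) * (1 - u) by ring.
  have -> : r + (t - r) * u - r = (t - r) * u by ring.
  rewrite !powRM//; try lra.
  rewrite mulrACA -powRD; last by rewrite (gt_eqF d0) implybT.
  have -> : - al + (al - 1) = -1 by ring.
  by rewrite powR_inv1 ?ltW.
rewrite ge0_integralZl//; last 3 first.
- apply/measurable_restrict => //; apply: measurable_funTS.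
  apply/measurable_EFinP.
  by have := @measurable_abel_kernel 0 1 setT; under eq_fun do rewrite subr0.
- by move=> s _; apply: erestrict_ge0 => x _; rewrite lee_fin mulr_ge0// powR_ge0.
- by rewrite lee_fin invr_ge0 ltW.
by rewrite muleA -EFinM divff ?gt_eqF// mul1e.
Qed.

Let measurable_ler (d : measure_display) (T : measurableType d) (f g : T -> R) :
  measurable_fun setT f -> measurable_fun setT g -> measurable [set x | f x <= g x].
Proof.
move=> mf mg; rewrite -[X in measurable X]setTI.
have /(_ [set true]) := measurable_fun_ler mf mg measurableT.
by rewrite preimage_true; exact.
Qed.

Let measurable_ltr (d : measure_display) (T : measurableType d) (f g : T -> R) :
  measurable_fun setT f -> measurable_fun setT g -> measurable [set x | f x < g x].
Proof.
move=> mf mg; rewrite -[X in measurable X]setTI.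
have /(_ [set true]) := measurable_fun_ltr mf mg measurableT.
by rewrite preimage_true; exact.
Qed.

(** Tonelli on the triangle a <= r <= s <= t; the inner integral over s is the constant [abel_beta].
    Nonnegativity allows the exchange before any integrability is known. *)
Lemma ge0_integral_abel a t (psi : R -> R) :
  measurable_fun `[a, t] psi -> (forall s, s \in `[a, t] -> 0 <= psi s) ->
  let f s := (((t - s) `^ (- al))%:E *
     \int[mu]_(r in `[a, s]) ((s - r) `^ (al - 1) * psi r)%:E)%E in
  measurable_fun `[a, t] f /\
  (\int[mu]_(s in `[a, t]) f s = abel_beta * \int[mu]_(r in `[a, t]) (psi r)%:E)%E.
Proof.
move=> mpsi psi0 f.
(* The condition r < t is strict because the inner integral has the value [abel_beta] only then; the
   lost line is negligible. *)
pose D := [set p : R * R | a <= p.2] `&` [set p | p.2 <= p.1] `&`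
  ([set p | p.1 <= t] `&` [set p | p.2 < t]).
pose psi' := psi \_ `[a, t].
have psi'0 r : 0 <= psi' r.
  by rewrite /psi' patchE; case: ifPn => // ; rewrite mem_setE => /psi0.
have mpsi' : measurable_fun setT psi'.
  by apply/measurable_restrict => //; rewrite setTI.
pose k (p : R * R) : \bar R :=
  ((t - p.1) `^ (- al) * (p.1 - p.2) `^ (al - 1) * psi' p.2 * (\1_D p))%:E.
have mD : measurable D.
  by apply: measurableI; apply: measurableI;
    [apply: measurable_ler|apply: measurable_ler|
     apply: measurable_ler|apply: measurable_ltr].
have mk : measurable_fun setT k.
  apply/measurable_EFinP/measurable_funM; last exact/measurable_indic.
  apply: measurable_funM; last exact: (measurableT_comp mpsi').
  apply: measurable_funM.
    apply: (measurableT_comp (measurable_powR _)).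
    exact: measurable_funB.
  apply: (measurableT_comp (measurable_powR _)).
  exact: measurable_funB.
have k0 p : (0 <= k p)%E.
  by rewrite lee_fin !mulr_ge0// powR_ge0.
have kD s r : (s, r) \notin D -> k (s, r) = 0%E.
  by move=> /negbTE sr; rewrite /k indicE sr mulr0.
have fE : f \_ `[a, t] = fun s => (\int[mu]_r k (s, r))%E.
  apply/funext => s; rewrite patchE /f.
  case: ifPn; rewrite mem_setE in_itv/=; last first.
    move=> sat; rewrite integral0_eq// => r _; rewrite kD//.
    by apply: contra sat; rewrite inE => -[[/= ? ?] [/= ? ?]]; lra.
  (* At s = t both sides vanish: [powR] sends 0 with a nonzero exponent, even a negative one, to
     0. *)
  move=> /andP[as_ st]; have [->|st'] := eqVneq s t.
    rewrite subrr powR0 ?oppr_eq0 ?gt_eqF//; last by case/andP: al01.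
    rewrite mul0e integral0_eq// => r _.
    by rewrite /k/= subrr powR0 ?oppr_eq0 ?gt_eqF ?mul0r//; case/andP: al01.
  have {}st' : s < t by rewrite lt_neqAle st'.
  rewrite -ge0_integralZl//; last 3 first.
  - apply/measurable_EFinP/measurable_funM; first exact: measurable_kernel.
    apply: measurable_funS mpsi => // r /=; rewrite !in_itv/=; lra.
  - move=> r; rewrite /= in_itv/= => rs; rewrite lee_fin mulr_ge0 ?powR_ge0//.
    by apply: psi0; rewrite in_itv/=; lra.
  - by rewrite lee_fin powR_ge0.
  rewrite [LHS]integral_mkcond; apply: eq_integral => r _; rewrite patchE.
  case: ifPn; rewrite mem_setE in_itv/= => rs.
    rewrite /k/= indicE mem_set ?mulr1; last by split; split => //=; lra.
    rewrite /psi' patchE mem_setE in_itv/= ifT -?EFinM ?mulrA//.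
    by case/andP: rs => -> /le_trans; exact.
  rewrite kD//; apply: contra rs; rewrite inE => -[[/= ? ?] [/= ? ?]]; lra.
split.
  have := measurable_fun_fubini_tonelli_F (m2 := mu) k mk k0.
  rewrite /fubini_F -fE => /measurable_restrict; rewrite setTI; exact.
rewrite [LHS]integral_mkcond fE fubini_tonelli//.
rewrite -integral_itv_bndo_bndc; last first.
  apply/measurable_EFinP; apply: measurable_funS mpsi => // r /=.
  by rewrite !in_itv/=; lra.
rewrite -ge0_integralZl//; last 3 first.
- apply/measurable_EFinP; apply: measurable_funS mpsi => // r /=.
  by rewrite !in_itv/=; lra.
- move=> r; rewrite /= in_itv/= => rs.
  by rewrite lee_fin; apply: psi0; rewrite in_itv/=; lra.
- by apply: integral_ge0 => r _; rewrite lee_fin mulr_ge0// powR_ge0.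
rewrite [RHS]integral_mkcond; apply: eq_integral => r _; rewrite patchE.
case: ifPn; rewrite mem_setE in_itv/=; last first.
  move=> rat; rewrite integral0_eq// => s _; rewrite kD//.
  by apply: contra rat; rewrite inE => -[[/= ? ?] [/= ? ?]]; lra.
move=> /andP[ar rt].
rewrite -(integral_abel_kernel rt) muleC -ge0_integralZl//; last 3 first.
- by apply/measurable_EFinP; exact: measurable_abel_kernel.
- by move=> s _; rewrite lee_fin mulr_ge0// powR_ge0.
- by rewrite lee_fin; apply: psi0; rewrite in_itv/=; lra.
rewrite [RHS]integral_mkcond; apply: eq_integral => s _; rewrite patchE.
case: ifPn; rewrite mem_setE in_itv/= => rs.
  rewrite /k/= indicE mem_set ?mulr1; last by split; split => //=; lra.
  rewrite /psi' patchE mem_setE in_itv/= ifT -?EFinM 1?mulrC//.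
  by rewrite ar ltW.
by rewrite kD//; apply: contra rs; rewrite inE => -[[/= ? ?] [/= ? ?]]; lra.
Qed.

(** The identity for psi = 1 on [0, 1] replaces the factor u^(al-1) by s^al / al, at most 1 / al.
    Only the singularity at 1 remains, and [integral_kernel] handles it. *)
Lemma abel_beta_lty : (abel_beta < +oo)%E.
Proof.
have al0 : 0 < al by case/andP: al01.
have I1 : (\int[mu]_(r in `[0%R, 1%R]) (cst 1%R r)%:E = 1)%E.
  transitivity (\int[mu]_(r in `[0%R, 1%R]) cst 1%E r)%E => //.
  by rewrite integral_cst//= lebesgue_measure_itv/= lte_fin ltr01 oppr0 adde0 mule1.
rewrite -[abel_beta]mule1 -I1.
have [|//|_ <-] := @ge0_integral_abel 0 1 (cst 1); first exact: measurable_cst.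
rewrite [X in (X < _)%E](_ : _ = \int[mu]_(s in `[0%R, 1%R])
    ((1 - s) `^ (- al) * (s `^ al / al))%:E)%E; last first.
  apply: eq_integral => s; rewrite mem_setE in_itv/= => /andP[s0 s1].
  rewrite EFinM; congr *%E.
  under eq_integral do rewrite mulr1.
  by rewrite integral_kernel// subr0.
apply: (@le_lt_trans _ _ (\int[mu]_(s in `[0%R, 1%R])
    ((al^-1)%:E * ((1 - s) `^ ((1 - al) - 1))%:E))%E).
  apply: ge0_le_integral => //.
  - by move=> s _; rewrite lee_fin !mulr_ge0 ?invr_ge0 ?powR_ge0// ltW.
  - apply/measurable_EFinP/measurable_funM; first exact: measurable_kernel.
    by apply: measurable_funM => //; apply: measurable_funTS; exact: measurable_powR.
  - by apply/measurable_EFinP/measurable_funM => //; exact: measurable_kernel.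
  - move=> s; rewrite /= in_itv/= => /andP[s0 s1].
    rewrite -EFinM lee_fin mulrC.
    rewrite (_ : 1 - al - 1 = - al); last by ring.
    rewrite ler_wpM2r ?powR_ge0// -[leRHS]mul1r ler_wpM2r ?invr_ge0 ?(ltW al0)//.
    rewrite (_ : 1 = 1 `^ al :> R); last by rewrite powR1.
    by apply: ge0_ler_powR; rewrite ?nnegrE// ltW.
rewrite ge0_integralZl//; last 3 first.
- by apply/measurable_EFinP; exact: measurable_kernel.
- by move=> s _; rewrite lee_fin powR_ge0.
- by rewrite lee_fin invr_ge0 ltW.
have al1 : 0 < 1 - al by case/andP: al01 => _; rewrite subr_gt0.
by rewrite integral_kernel// -EFinM ltry.
Qed.

Lemma abel_beta_ge0 : (0 <= abel_beta)%E.
Proof. by apply: integral_ge0 => u _; rewrite lee_fin mulr_ge0// powR_ge0. Qed.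

(** The scalar fractional integral without the factor 1 / Gamma(al). *)
Definition frac_kernel_int a (psi : R -> R) s : R :=
  \int[mu]_(r in `[a, s]) ((s - r) `^ (al - 1) * psi r).

Lemma integrable_bounded_kernel g a t M (psi : R -> R) : 0 < g -> a <= t ->
  measurable_fun `[a, t] psi -> (forall s, s \in `[a, t] -> `|psi s| <= M) ->
  mu.-integrable `[a, t] (fun s => ((t - s) `^ (g - 1) * psi s)%:E).
Proof.
move=> g0 at_ mpsi psiM.
apply: le_integrable (integrableZl _ M (integrable_kernel g0 at_)) => //.
- by apply/measurable_EFinP/measurable_funM => //; exact: measurable_kernel.
- move=> s sat; rewrite -EFinM !abse_EFin lee_fin !normrM mulrC.
  rewrite ler_wpM2r// (le_trans (psiM _ sat))//; exact: ler_norm.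
Qed.

Let ge0_Rintegral_abel a t M (psi : R -> R) : a <= t ->
  measurable_fun `[a, t] psi -> (forall s, s \in `[a, t] -> 0 <= psi s <= M) ->
  mu.-integrable `[a, t] (fun s => ((t - s) `^ (- al) * frac_kernel_int a psi s)%:E) /\
  \int[mu]_(s in `[a, t]) ((t - s) `^ (- al) * frac_kernel_int a psi s) =
  fine abel_beta * \int[mu]_(r in `[a, t]) psi r.
Proof.
move=> at_ mpsi psiM.
have al0 : 0 < al by case/andP: al01.
have [mf fE] := @ge0_integral_abel a t psi mpsi (fun s sat => proj1 (andP (psiM s sat))).
have ifin : mu.-integrable `[a, t] (fun r => (psi r)%:E).
  apply: measurable_bounded_integrable => //.
  - by rewrite /= lebesgue_measure_itv/=; case: ifP => _; rewrite ltry.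
  - exists M; split; first exact: num_real.
    move=> N MN s /= sat; have /andP[? /le_trans] := psiM s sat.
    by rewrite ger0_norm//; apply; exact: ltW.
have ekE s : s \in `[a, t] -> (((t - s) `^ (- al) * frac_kernel_int a psi s)%:E =
    ((t - s) `^ (- al))%:E *
     \int[mu]_(r in `[a, s]) ((s - r) `^ (al - 1) * psi r)%:E)%E.
  rewrite in_itv/= => /andP[as_ st].
  rewrite EFinM; congr *%E; rewrite /frac_kernel_int /Rintegral fineK//.
  apply: integrable_fin_num => //; apply: (@integrable_bounded_kernel _ _ _ M) => //.
  - by apply: measurable_funS mpsi => // r /=; rewrite !in_itv/=; lra.
  - move=> r; rewrite in_itv/= => rs; have /andP[] : 0 <= psi r <= M.
      by apply: psiM; rewrite in_itv/=; lra.
    by move=> ? ?; rewrite ger0_norm.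
have fE' : (\int[mu]_(s in `[a, t]) ((t - s) `^ (- al) * frac_kernel_int a psi s)%:E =
  abel_beta * \int[mu]_(r in `[a, t]) (psi r)%:E)%E.
  rewrite -fE; apply: eq_integral => s; rewrite mem_setE; exact: ekE.
have Bfin : abel_beta \is a fin_num.
  by rewrite ge0_fin_numE ?abel_beta_lty// abel_beta_ge0.
split; last by rewrite /Rintegral fE' fineM//; exact: integrable_fin_num.
apply/integrableP; split.
  by apply: eq_measurable_fun mf => s; rewrite mem_setE => /ekE ->.
rewrite (_ : (\int[mu]_(x in _) _)%E = abel_beta * \int[mu]_(r in `[a, t]) (psi r)%:E)%E.
  by rewrite ltey_eq fin_numM//; exact: integrable_fin_num.
rewrite -fE'; apply: eq_integral => s; rewrite mem_setE => sat.
rewrite gee0_abs// lee_fin mulr_ge0 ?powR_ge0//; apply: Rintegral_ge0 => r /=.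
rewrite in_itv/= => rs; rewrite mulr_ge0 ?powR_ge0//.
have /psiM/andP[] // : r \in `[a, t].
by move: sat; rewrite !in_itv/=; lra.
Qed.

Lemma integrable_bounded a t M (f : R -> R) :
  measurable_fun `[a, t] f -> (forall s, s \in `[a, t] -> `|f s| <= M) ->
  mu.-integrable `[a, t] (fun r => (f r)%:E).
Proof.
move=> mf fM; apply: measurable_bounded_integrable => //.
- by rewrite /= lebesgue_measure_itv/=; case: ifP => _; rewrite ltry.
- exists M; split; first exact: num_real.
  by move=> N MN s /= sat; rewrite (le_trans (fM s sat))// ltW.
Qed.

(** A bounded psi is the difference of the nonnegative functions psi + M and M, and the identity is
    linear. *)
Lemma Rintegral_abel a t M (psi : R -> R) : a <= t ->
  measurable_fun `[a, t] psi -> (forall s, s \in `[a, t] -> `|psi s| <= M) ->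
  \int[mu]_(s in `[a, t]) ((t - s) `^ (- al) * frac_kernel_int a psi s) =
  fine abel_beta * \int[mu]_(r in `[a, t]) psi r.
Proof.
move=> at_ mpsi psiM.
have al0 : 0 < al by case/andP: al01.
have M0 : 0 <= M.
  by apply: le_trans (psiM a _); rewrite ?normr_ge0// in_itv/= lexx.
have mD : measurable_fun `[a, t] (fun s => psi s + M) by exact: measurable_funD.
have psiM0 s : s \in `[a, t] -> 0 <= psi s + M <= M + M.
  by move=> /psiM; rewrite ler_norml; lra.
have [i1 e1] := ge0_Rintegral_abel at_ mD psiM0.
have M0M s : s \in `[a, t] -> 0 <= cst M s <= M by rewrite /= lexx M0.
have [i2 e2] := ge0_Rintegral_abel at_ (measurable_cst M) M0M.
have subE s : s \in `[a, t] -> frac_kernel_int a psi s =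
    frac_kernel_int a (fun s => psi s + M) s - frac_kernel_int a (cst M) s.
  rewrite in_itv/= => /andP[as_ st].
  have sub : `[a, s] `<=` `[a, t] by move=> r /=; rewrite !in_itv/=; lra.
  rewrite /frac_kernel_int -RintegralB//.
  - by apply: eq_Rintegral => r _; rewrite -mulrBr addrK.
  - apply: (@integrable_bounded_kernel _ _ _ (M + M)) => //.
      exact: measurable_funS mD.
    move=> r /sub/psiM psirM; rewrite (le_trans (ler_normD _ _))//.
    by rewrite (ger0_norm M0) lerD2r.
  - by apply: (@integrable_bounded_kernel _ _ _ M) => // r _; rewrite ger0_norm.
transitivity (\int[mu]_(s in `[a, t])
    ((t - s) `^ (- al) * frac_kernel_int a (fun s => psi s + M) s -
     (t - s) `^ (- al) * frac_kernel_int a (cst M) s)).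
  by apply: eq_Rintegral => s; rewrite mem_setE => sat; rewrite subE// mulrBr.
rewrite RintegralB// e1 e2 -mulrBr -RintegralB//.
- by congr *%R; apply: eq_Rintegral => s _; rewrite addrK.
- apply: (@integrable_bounded _ _ (M + M)) => // s /psiM psisM.
  by rewrite (le_trans (ler_normD _ _))// (ger0_norm M0) lerD2r.
- by apply: (@integrable_bounded _ _ M) => // s _; rewrite ger0_norm.
Qed.

End AbelKernel.

(** * Piecewise continuous functions *)

Section PiecewiseContinuity.
Context {R : realType}.
Implicit Types (t s : R) (F G : seq R).

Lemma near_notin_seq F t : \forall s \near t, s != t -> s \notin F.
Proof.
elim: F => [|a F IH]; first by near=> s.
case: (eqVneq t a) IH => [->|ta] IH.
  by apply: filterS IH => s sF st; rewrite inE negb_or st sF.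
near=> s => st; rewrite inE negb_or; apply/andP; split.
  near: s; exists `|t - a|; first by rewrite /= normr_gt0 subr_eq0.
  by move=> s /= + ; apply: contraTneq => ->; rewrite ltxx.
exact: (near IH s).
Unshelve. all: by end_near. Qed.

Lemma near_left_in t0 t1 t : t0 < t <= t1 -> \forall s \near t^'-, t0 <= s <= t1.
Proof.
move=> /andP[t0t tt1]; near=> s; apply/andP; split.
  by near: s; exact: nbhs_left_ge.
by apply: le_trans tt1; near: s; exact: nbhs_left_le.
Unshelve. all: by end_near. Qed.

Lemma near_right_in t0 t1 t : t0 <= t < t1 -> \forall s \near t^'+, t0 <= s <= t1.
Proof.
move=> /andP[t0t tt1]; near=> s; apply/andP; split.
  by apply: le_trans t0t _; near: s; exact: nbhs_right_ge.
by near: s; exact: nbhs_right_le.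
Unshelve. all: by end_near. Qed.

Lemma near_in t0 t1 t : t0 < t < t1 -> \forall s \near t, t0 <= s <= t1.
Proof.
move=> tin; have : t \in `]t0, t1[ by rewrite in_itv.
move/near_in_itvoo; apply: filterS => s; rewrite in_itv/= => /andP[? ?].
by rewrite !ltW.
Qed.

Lemma within_itv_left t0 t1 t : t0 < t <= t1 ->
  cvg_to (t^'-) (within `[t0, t1] (nbhs t)).
Proof.
move=> tin A [e /= e0 eA]; have := near_left_in tin.
have : \forall s \near t^'-, ball t e s.
  by apply: cvg_within; exact: nbhsx_ballx.
by apply: filterS2 => s ts sin; apply: eA => //; rewrite /= in_itv.
Qed.

Lemma within_itv_right t0 t1 t : t0 <= t < t1 ->
  cvg_to (t^'+) (within `[t0, t1] (nbhs t)).
Proof.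
move=> tin A [e /= e0 eA]; have := near_right_in tin.
have : \forall s \near t^'+, ball t e s.
  by apply: cvg_within; exact: nbhsx_ballx.
by apply: filterS2 => s ts sin; apply: eA => //; rewrite /= in_itv.
Qed.

Lemma within_itv_nbhs t0 t1 t : t0 < t < t1 ->
  within `[t0, t1] (nbhs t) = nbhs t.
Proof.
move=> tin; apply/seteqP; split=> A; last by move=> At; apply: filterS At => s ? _.
by have := near_in tin; apply: filterS2 => s sin; apply; rewrite /= in_itv.
Qed.

Section Values.
Context {V : normedModType R}.
Implicit Types f g : R -> V.

Lemma continuous_at_in_left t0 t1 f t : t0 < t <= t1 ->
  continuous_at_in t0 t1 f t -> f @ t^'- --> f t.
Proof. by move=> tin; apply: cvg_trans; apply: cvg_app; exact: within_itv_left. Qed.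

Lemma continuous_at_in_right t0 t1 f t : t0 <= t < t1 ->
  continuous_at_in t0 t1 f t -> f @ t^'+ --> f t.
Proof. by move=> tin; apply: cvg_trans; apply: cvg_app; exact: within_itv_right. Qed.

Lemma continuous_at_in_interior t0 t1 f t : t0 < t < t1 ->
  continuous_at_in t0 t1 f t <-> {for t, continuous f}.
Proof. by move=> tin; rewrite /continuous_at_in within_itv_nbhs. Qed.

(* Unlike in PC, F need not consist of genuine discontinuities, which makes
   this notion stable under linear combinations. *)
Definition piecewise_continuous t0 t1 F f :=
  [/\ forall t, t0 < t <= t1 -> cvg (f @ t^'-),
      forall t, t0 <= t < t1 -> cvg (f @ t^'+)
    & forall t, t0 <= t <= t1 -> t \notin F -> continuous_at_in t0 t1 f t].

Lemma PC_piecewise_continuous t0 t1 f : PC t0 t1 f ->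
  exists2 F, (forall s, s \in F -> t0 < s < t1) & piecewise_continuous t0 t1 F f.
Proof.
case=> F [Fin Fdisc fc]; exists F => //; split=> // t tin.
- have [/Fdisc[]//|tF] := boolP (t \in F).
  apply/cvg_ex; exists (f t); apply: (continuous_at_in_left tin); apply: fc => //.
  by case/andP: tin => /ltW -> ->.
- have [/Fdisc[]//|tF] := boolP (t \in F).
  apply/cvg_ex; exists (f t); apply: (continuous_at_in_right tin); apply: fc => //.
  by case/andP: tin => -> /ltW ->.
Qed.

Lemma piecewise_continuous_PC t0 t1 F f : (forall s, s \in F -> t0 < s < t1) ->
  piecewise_continuous t0 t1 F f -> PC t0 t1 f.
Proof.
move=> Fin [fl fr fc].
(* [PC] lists genuine discontinuities only, so points of F where f is continuous are dropped. *)
exists [seq s <- F | `[< ~ {for s, continuous f} >]]; split.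
- by move=> s; rewrite mem_filter => /andP[_]; exact: Fin.
- move=> s; rewrite mem_filter => /andP[/asboolP sd /Fin/andP[t0s st1]].
  by split=> //; [apply: fl|apply: fr]; rewrite ?t0s ?st1 ?ltW.
- move=> t tin; rewrite mem_filter negb_and => /orP[|]; last exact: fc.
  rewrite asbool_neg negbK => /asboolP ct.
  by apply: cvg_trans ct; apply: cvg_app; exact: cvg_within.
Qed.

(** One-sided limits do not see finitely many values. This transfers the notion to Caputo
    derivatives, which are computed only off F. *)
Lemma piecewise_continuous_eq t0 t1 F f g :
  (forall t, t0 <= t <= t1 -> t \notin F -> g t = f t) ->
  piecewise_continuous t0 t1 F f -> piecewise_continuous t0 t1 F g.
Proof.
move=> gf [fl fr fc].
have gfn t : \forall s \near t^', t0 <= s <= t1 -> g s = f s.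
  have := near_notin_seq F t; rewrite near_withinE; apply: filterS => s sF st sin.
  by apply: gf => //; exact: sF.
have dl t : t0 < t <= t1 -> {near t^'-, g =1 f}.
  move=> tin; have := near_left_in tin.
  have : \forall s \near t^'-, t0 <= s <= t1 -> g s = f s.
    by have := gfn t; rewrite !near_withinE; apply: filterS => s + /lt_eqF/negbT; apply.
  by apply: filterS2 => s gs /gs.
have dr t : t0 <= t < t1 -> {near t^'+, g =1 f}.
  move=> tin; have := near_right_in tin.
  have : \forall s \near t^'+, t0 <= s <= t1 -> g s = f s.
    by have := gfn t; rewrite !near_withinE; apply: filterS => s + /gt_eqF/negbT; apply.
  by apply: filterS2 => s gs /gs.
split=> t tin.
- have /cvg_ex[l fll] := fl t tin; apply/cvg_ex; exists l.
  apply: cvg_trans fll; apply: near_eq_cvg.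
  by have := dl t tin; apply: filterS => s ->.
- have /cvg_ex[l fll] := fr t tin; apply/cvg_ex; exists l.
  apply: cvg_trans fll; apply: near_eq_cvg.
  by have := dr t tin; apply: filterS => s ->.
- move=> tF; rewrite /continuous_at_in gf//.
  apply: cvg_trans (fc t tin tF); apply: near_eq_cvg.
  rewrite near_withinE; have := gfn t; rewrite near_withinE; apply: filterS => s.
  rewrite /= in_itv/= => gs sin; have [->|st] := eqVneq s t; first by rewrite gf.
  by rewrite gs.
Qed.

Lemma piecewise_continuousD t0 t1 F G f g (k : R) :
  piecewise_continuous t0 t1 F f -> piecewise_continuous t0 t1 G g ->
  piecewise_continuous t0 t1 (F ++ G) (fun t => f t + k *: g t).
Proof.
move=> [fl fr fc] [gl gr gc]; split=> t tin.
- by apply: is_cvgD; [exact: fl|apply: is_cvgZr; exact: gl].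
- by apply: is_cvgD; [exact: fr|apply: is_cvgZr; exact: gr].
- rewrite mem_cat negb_or => /andP[tF tG].
  by apply: cvgD; [exact: fc|apply: cvgZr; exact: gc].
Qed.

End Values.
End PiecewiseContinuity.

(** * Uniform estimates across jumps, by compactness *)

Section SideCovering.
Context {R : realType}.
Implicit Types (t s r : R) (F : seq R).
Notation mu := (@lebesgue_measure R).

(** At a jump the two sides obey different local estimates, and the value at the point obeys none.
    Compactness of the segment still gives one radius r once left, right and pointwise conditions
    are glued near each t. *)
Lemma near_covering_sides t0 t1 F (P : R -> R -> Prop) :
  (forall t, t0 < t <= t1 -> \forall s \near t^'- & r \near 0^'+, P r s) ->
  (forall t, t0 <= t < t1 -> \forall s \near t^'+ & r \near 0^'+, P r s) ->
  (forall t, t0 <= t <= t1 -> t \notin F -> \forall r \near 0^'+, P r t) ->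
  \forall r \near 0^'+, forall s, t0 <= s <= t1 -> s \notin F -> P r s.
Proof.
move=> PL PR PF.
have /near_covering_withinP cov : near_covering `[t0, t1].
  by apply/compact_near_coveringP; exact: segment_compact.
have {cov} := cov _ (0%R^'+) (fun r s => s \notin F -> P r s) _ _.
move=> cov; have {cov} : \forall r \near 0^'+,
    `[t0, t1] `<=` (fun s => s \notin F -> P r s).
  apply: cov => t; rewrite /= in_itv/= => tin.
  have [A [B [tA B0 AB]]] : exists A B : set R, [/\ \forall s \near t, s < t -> A s,
      \forall r \near 0^'+, B r &
      forall s r, t0 <= s <= t1 -> s < t -> A s -> B r -> P r s].
    (* At the left endpoint no point of the segment lies to the left, so trivial neighborhoods
       suffice. *)
    have [tt0|t0t] := leP t t0.
      exists (fun=> True), (fun=> True); split; [by near=> s|by near=> s|].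
      by move=> s r /andP[t0s _] /lt_le_trans/(_ tt0); rewrite ltNge t0s.
    have [|[A B] [/= tA B0] AB] := PL t.
      by rewrite t0t; case/andP: tin.
    exists A, B; split=> //.
    by move=> s r _ _ As Br; exact: (AB (s, r)).
  have [A' [B' [tA' B'0 AB']]] : exists A B : set R, [/\ \forall s \near t, t < s -> A s,
      \forall r \near 0^'+, B r &
      forall s r, t0 <= s <= t1 -> t < s -> A s -> B r -> P r s].
    have [tt1|t1t] := leP t1 t.
      exists (fun=> True), (fun=> True); split; [by near=> s|by near=> s|].
      by move=> s r /andP[_ st1] /(le_lt_trans tt1); rewrite ltNge st1.
    have [|[A' B'] [/= tA' B'0] AB'] := PR t.
      by rewrite t1t andbT; case/andP: tin.
    exists A', B'; split=> //.
    by move=> s r _ _ As Br; exact: (AB' (s, r)).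
  have PFt : \forall r \near 0^'+, t \notin F -> P r t.
    have [tF|tF] := boolP (t \in F); first by apply: nearW.
    by have := PF t tin tF; apply: filterS.
  near=> s r => /=; rewrite in_itv/= => sin sF.
  have [st|ts|st] := ltgtP s t.
  - by apply: AB => //; [exact: (near tA s)|exact: (near B0 r)].
  - by apply: AB' => //; [exact: (near tA' s)|exact: (near B'0 r)].
  - by rewrite st in sF *; exact: (near PFt r).
by apply: filterS => r Pr s sin; apply: Pr; rewrite /= in_itv.
Unshelve. all: by end_near. Qed.

(** The covering lemma with r^-1 as the bound: near each side f is within 1 of its limit, and r^-1
    exceeds any constant as r tends to 0. *)
Lemma piecewise_continuous_bounded {V : normedModType R} t0 t1 F (f : R -> V) :
  piecewise_continuous t0 t1 F f ->
  exists2 M, 0 < M & forall t, t0 <= t <= t1 -> `|f t| <= M.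
Proof.
move=> [fl fr fc].
have bnd (G : set_system R) (FG : ProperFilter G) (l : V) : f @ G --> l ->
    \forall s \near G & r \near 0^'+, `|f s| <= r^-1.
  move=> fGl; exists ([set s | `|f s| <= `|l| + 1], [set r | 0 < r < (`|l| + 1)^-1]); last first.
    move=> [s r]/= [/le_trans + /andP[r0 rl]]; apply.
    by rewrite -[leLHS]invrK lef_pV2 ?posrE ?invr_gt0 ?ltr_wpDl// ltW.
  split=> /=.
    have /cvgrPdist_le/(_ 1 ltr01) := fGl; apply: filterS => s.
    rewrite /= distrC -lerBlDl; apply: le_trans; exact: lerB_dist.
  near=> r; apply/andP; split; near: r; first exact: nbhs_right_gt.
  by apply: nbhs_right_lt; rewrite invr_gt0 ltr_wpDl.
have cov : \forall r \near 0^'+, forall s, t0 <= s <= t1 -> s \notin [::] -> `|f s| <= r^-1.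
  apply: near_covering_sides => t tin.
  - by have /cvg_ex[l fll] := fl t tin; exact: bnd fll.
  - by have /cvg_ex[l fll] := fr t tin; exact: bnd fll.
  - move=> _; near=> r.
    have r0 : 0 < r by near: r; exact: nbhs_right_gt.
    rewrite (@le_trans _ _ (`|f t| + 1)) ?lerDl//.
    rewrite -[leLHS]invrK lef_pV2 ?posrE ?invr_gt0 ?ltr_wpDl//.
    by near: r; apply: nbhs_right_le; rewrite invr_gt0 ltr_wpDl.
near (0 : R)^'+ => r.
exists r^-1; first by rewrite invr_gt0.
by move=> t tin; apply: (near cov r).
Unshelve. all: by end_near. Qed.

Lemma measurable_fun_piecewise_continuous t0 t1 F (f : R -> R) :
  (forall t, t0 < t < t1 -> t \notin F -> {for t, continuous f}) ->
  measurable_fun `[t0, t1] f.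
Proof.
move=> fc.
pose D := `]t0, t1[%classic `\` [set` F].
have oD : open D.
  rewrite /D setDE; apply: openI; first exact: interval_open.
  rewrite openC; apply: accessible_finite_set_closed.1; last exact: finite_seq.
  exact/hausdorff_accessible/Rhausdorff.
have mfD : measurable_fun D f.
  apply: open_continuous_measurable_fun => // t; rewrite inE => -[/=].
  rewrite in_itv/= => tin /negP tF; exact: fc.
(* On this finite set every subset is measurable, whatever the values of f; elsewhere f is
   continuous on an open set. *)
pose E := `[t0, t1]%classic `&` [set` t0 :: t1 :: F].
have mE A : A `<=` E -> measurable A.
  move=> AE; apply: countable_measurable; first exact: measurable_set1.
  apply: finite_set_countable.
  apply: sub_finite_set (finite_seq (t0 :: t1 :: F)).
  by apply: subset_trans AE _; exact: subIsetr.
have -> : `[t0, t1]%classic = D `|` E.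
  apply/seteqP; split=> t /=; last by case=> -[]//=;
    rewrite !in_itv/= => /andP[? ?] _; rewrite !ltW.
  move=> tin; have [tE|] := boolP (t \in [:: t0, t1 & F]); first by right.
  rewrite !inE !negb_or => /and3P[tt0 tt1 tF]; left; split; last exact/negP.
  move: tin; rewrite /= !in_itv/= => /andP[t0t tt].
  by rewrite !lt_neqAle t0t tt eq_sym tt0 tt1.
apply/measurable_funU => //; first exact: open_measurable.
  exact: mE.
split=> //.
by move=> _ Y _; apply: mE; exact: subIsetl.
Qed.

End SideCovering.

Section RowVectors.
Context {R : realType} {n : nat}.
Implicit Types v : 'rV[R]_n.

Lemma rV_norm_le v (e : R) : 0 <= e -> (forall i, `|v 0 i| <= e) -> `|v| <= e.
Proof.
move=> e0 ve; rewrite /Num.norm/= mx_normrE; apply: bigmax_le => // -[i j] _ /=.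
by rewrite ord1.
Qed.

Lemma rV_coord_le v i : `|v 0 i| <= `|v|.
Proof.
rewrite /Num.norm/= mx_normrE.
exact: (le_bigmax _ (fun ij : 'I_1 * 'I_n => `|v ij.1 ij.2|) (0, i)).
Qed.

Lemma cvg_coord {T : Type} (G : set_system T) (FG : Filter G) (f : T -> 'rV[R]_n) v i :
  f @ G --> v -> (fun s => f s 0 i) @ G --> v 0 i.
Proof. move=> fv; exact: (cvg_comp _ _ fv (@coord_continuous _ _ _ 0 i v)). Qed.

End RowVectors.

(** * The fundamental theorem of calculus relative to a segment *)

Section IntegralDerivative.
Context {R : realType}.
Notation mu := (@lebesgue_measure R).
Implicit Types (a b t s l M : R).

Lemma Rintegral_increment t0 t1 M (f : R -> R) a b l (e : R) :
  measurable_fun `[t0, t1] f -> (forall s, s \in `[t0, t1] -> `|f s| <= M) ->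
  t0 <= a -> a < b -> b <= t1 ->
  (forall s, a < s < b -> `|f s - l| <= e) ->
  `|\int[mu]_(s in `[t0, b]) f s - \int[mu]_(s in `[t0, a]) f s - l * (b - a)| <=
    e * (b - a).
Proof.
move=> mf fM t0a ab bt1 fl.
have itf c d : t0 <= c -> d <= t1 -> mu.-integrable `[c, d] (EFin \o f).
  move=> t0c dt1; apply: (@integrable_bounded _ _ _ M).
    by apply: measurable_funS mf => // s /=; rewrite !in_itv/=; lra.
  by move=> s; rewrite in_itv/= => sin; apply: fM; rewrite in_itv/=; lra.
rewrite Rintegral_itvB//; last 2 first.
- exact: itf.
- by rewrite bnd_simp ltW.
have sub (c d : bool) : [set` Interval (BSide c a) (BSide d b)] `<=` `[a, b].
  move=> s; rewrite /= !in_itv/= => /andP[].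
  by move=> /lteifW -> /lteifW ->.
have ioo : mu.-integrable `]a, b[ (EFin \o f).
  by apply: integrableS (itf a b t0a bt1) => //; exact: sub.
have icst (k : R) : mu.-integrable `]a, b[ (EFin \o cst k).
  have iab : mu.-integrable `[a, b] (EFin \o cst k).
    by apply: (@integrable_bounded _ _ _ `|k|) => //; exact: measurable_cst.
  by apply: integrableS iab => //; exact: sub.
have muab : fine (mu `]a, b[) = b - a.
  by rewrite /= lebesgue_measure_itv/= lte_fin ab.
rewrite -Rintegral_itv_bndo_bndc//.
have cstE (k : R) : k * (b - a) = \int[mu]_(s in `]a, b[) cst k s.
  by rewrite Rintegral_cst// muab.
rewrite (cstE l) (cstE e) -(RintegralB _ ioo (icst l))//.
have ifl : mu.-integrable `]a, b[ (EFin \o (fun s => f s - cst l s)).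
  by apply: (integrableB _ ioo (icst l)).
apply: le_trans (le_normr_Rintegral _ ifl) _ => //.
by apply: le_Rintegral => //; exact: integrable_norm.
Qed.

Lemma cvg_Rintegral_quotient t0 t1 M (f : R -> R) t : t0 < t1 -> t0 <= t <= t1 ->
  measurable_fun `[t0, t1] f -> (forall s, s \in `[t0, t1] -> `|f s| <= M) ->
  continuous_at_in t0 t1 f t ->
  (s - t)^-1 * (\int[mu]_(r in `[t0, s]) f r - \int[mu]_(r in `[t0, t]) f r)
    @[s --> within `[t0, t1] t^'] --> f t.
Proof.
move=> t01 /andP[t0t tt1] mf fM ft; apply/cvgrPdist_le => e e0.
have := ft; move/cvgrPdist_le/(_ e e0) => [d /= d0 fd].
exists d => //= s /= std st; rewrite in_itv/= => sin.
have close r : `|r - t| < d -> t0 <= r <= t1 -> `|f r - f t| <= e.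
  by move=> rt rin; rewrite distrC; apply: fd; rewrite /= ?in_itv// distrC.
rewrite distrC.
set I := Rintegral _ _ _ - _.
have -> : (s - t)^-1 * I - f t = (s - t)^-1 * (I - f t * (s - t)).
  by field; rewrite subr_eq0.
rewrite normrM normfV ler_pdivrMl ?normr_gt0 ?subr_eq0// [leRHS]mulrC.
rewrite distrC in std.
(* [Rintegral_increment] runs from left to right, so for s < t both increments change sign. *)
have [lt_st|lt_ts|] := ltgtP s t; last by move/eqP; rewrite (negbTE st).
  have -> : I - f t * (s - t) = - ((\int[mu]_(r in `[t0, t]) f r -
      \int[mu]_(r in `[t0, s]) f r) - f t * (t - s)) by rewrite /I; ring.
  rewrite normrN [leRHS](_ : _ = e * (t - s)); last first.
    by rewrite ltr0_norm ?subr_lt0// opprB.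
  apply: (Rintegral_increment mf fM) => //; first by case/andP: sin.
  move=> r rst; apply: close; last by lra.
  by move: std; rewrite !ltr_norml; lra.
rewrite [X in e * X]gtr0_norm ?subr_gt0//.
apply: (Rintegral_increment mf fM) => //; first by case/andP: sin.
move=> r rst; apply: close; last by lra.
by move: std; rewrite !ltr_norml; lra.
Qed.

End IntegralDerivative.

(** * The Caputo derivative on PC^alpha *)

Section CaputoOfFractionalIntegral.
Context {R : realType} {n : nat}.
Notation mu := (@lebesgue_measure R).
Implicit Types (t s al : R) (phi psi : R -> 'rV[R]_n).

Lemma piecewise_continuous_coord t0 t1 F psi i : piecewise_continuous t0 t1 F psi ->
  measurable_fun `[t0, t1] (fun t => psi t 0 i) /\
  exists M, forall t, t \in `[t0, t1] -> `|psi t 0 i| <= M.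
Proof.
move=> psiF; split; last first.
  have [M _ psiM] := piecewise_continuous_bounded psiF.
  exists M => t; rewrite in_itv/= => tin.
  by apply: le_trans (psiM t tin); exact: rV_coord_le.
apply: (@measurable_fun_piecewise_continuous _ _ _ F) => t tin tF.
case: psiF => _ _ /(_ t _ tF) ct; apply: cvg_coord.
by apply/(continuous_at_in_interior _ tin)/ct; case/andP: tin => /ltW -> /ltW ->.
Qed.

(** The function whose derivative is the Caputo derivative, so that alpha = 1 and alpha < 1 share
    one differentiation argument. *)
Definition caputo_primitive t0 al phi s : 'rV[R]_n :=
  if al == 1 then phi s else frac_int t0 (1 - al) (fun r => phi r - phi t0) s.

Lemma caputo_primitiveP t0 t1 al phi :
  caputo t0 t1 al phi = derive_in t0 t1 (caputo_primitive t0 al phi).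
Proof. by rewrite /caputo /caputo_primitive; case: ifP. Qed.

(** The two cases are 1 / Gamma(1) and B(al, 1 - al) / (Gamma(1 - al) Gamma(al)). *)
Definition caputo_cst al : R :=
  if al == 1 then (Gamma al)^-1
  else (Gamma (1 - al))^-1 * fine (abel_beta al) * (Gamma al)^-1.

(** Composing the fractional integrals of orders 1 - al and al gives a multiple of the plain
    integral: Abel's identity in each coordinate. For al = 1 the kernel is 1 and the initial value
    remains as a constant, which differentiation removes. *)
Lemma caputo_primitiveE t0 t1 al F phi psi : 0 < al <= 1 ->
  piecewise_continuous t0 t1 F psi ->
  (forall t, t0 <= t <= t1 -> phi t = phi t0 + frac_int t0 al psi t) ->
  forall s, t0 <= s <= t1 -> caputo_primitive t0 al phi s =
    (if al == 1 then phi t0 else 0) +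
    caputo_cst al *: \row_i \int[mu]_(r in `[t0, s]) psi r 0 i.
Proof.
move=> al01 psiF phiE s sin; rewrite /caputo_primitive /caputo_cst.
have [al1|al1] := eqVneq al 1.
  rewrite al1 in phiE *.
  rewrite (phiE s sin) /frac_int; apply/rowP => i; rewrite !mxE.
  congr (_ + _ * _).
  by apply: eq_Rintegral => r _; rewrite subrr powRr0 mul1r.
have {}al01 : 0 < al < 1 by case/andP: al01 => -> ; rewrite lt_neqAle al1.
rewrite add0r /frac_int -!scalerA; congr (_ *: _); apply/rowP => i; rewrite !mxE.
have [mpsi [M psiM]] := piecewise_continuous_coord i psiF.
have /andP[t0s st1] := sin.
have sub r : r \in `[t0, s] -> r \in `[t0, t1] by rewrite !in_itv/=; lra.
pose g := (Gamma al)^-1.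
have mg : measurable_fun `[t0, s] (fun r => g * psi r 0 i).
  by apply: measurable_funM => //; apply: measurable_funS mpsi => // r; exact: sub.
have gM r : r \in `[t0, s] -> `|g * psi r 0 i| <= `|g| * M.
  by move=> /sub /psiM psirM; rewrite normrM ler_wpM2l.
transitivity (\int[mu]_(r in `[t0, s]) ((s - r) `^ (- al) *
    frac_kernel_int al t0 (fun r => g * psi r 0 i) r)).
  apply: eq_Rintegral => r; rewrite mem_setE => rin.
  have -> : 1 - al - 1 = - al by ring.
  congr (_ * _); rewrite phiE; last by have := sub _ rin; rewrite in_itv.
  rewrite addrAC subrr add0r !mxE /frac_kernel_int -RintegralZl//.
    by apply: eq_Rintegral => q _; rewrite mulrCA.
  apply: (@integrable_bounded_kernel _ _ _ _ M).
  - by case/andP: al01.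
  - by move: rin; rewrite in_itv => /andP[].
  - apply: measurable_funS mpsi => // q /= qin; apply: sub.
    by move: rin qin; rewrite !in_itv/=; lra.
  - move=> q qin; apply/psiM/sub; move: rin qin; rewrite !in_itv/=; lra.
rewrite (@Rintegral_abel _ _ al01 _ _ (`|g| * M))// RintegralZl//.
apply: (@integrable_bounded _ _ _ M) => [|r /sub]; last exact: psiM.
by apply: measurable_funS mpsi => // r; exact: sub.
Qed.

(** The [lim] in [derive_in] is determined by convergence only along a proper filter. At least one
    side of t always lies in the segment. *)
Lemma within_itv_dnbhs_proper t0 t1 t : t0 < t1 -> t0 <= t <= t1 ->
  ProperFilter (within `[t0, t1] t^').
Proof.
move=> t01 tin; split; last exact: within_filter.
rewrite /within/= => t0F.
have {}t0F : \forall s \near within `[t0, t1] (nbhs t), s != t -> False.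
  by rewrite near_withinE; move: t0F; rewrite near_withinE;
    apply: filterS => s sF sin st; exact: sF st sin.
have [tt1|t1t] := ltP t t1.
  have tR : t0 <= t < t1 by rewrite tt1 andbT; case/andP: tin.
  have : \forall s \near t^'+, False.
    have := within_itv_right tR t0F; have := nbhs_right_neq t.
    by apply: filterS2 => s st /(_ st).
  by move/filter_ex => -[].
have tL : t0 < t <= t1 by case/andP: tin => _ ->; rewrite (lt_le_trans t01).
have : \forall s \near t^'-, False.
  have := within_itv_left tL t0F; have := nbhs_left_neq t.
  by apply: filterS2 => s st /(_ st).
by move/filter_ex => -[].
Qed.

Lemma caputoE t0 t1 al F phi psi : t0 < t1 -> 0 < al <= 1 ->
  piecewise_continuous t0 t1 F psi ->
  (forall t, t0 <= t <= t1 -> phi t = phi t0 + frac_int t0 al psi t) ->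
  forall t, t0 <= t <= t1 -> t \notin F ->
    caputo t0 t1 al phi t = caputo_cst al *: psi t.
Proof.
move=> t01 al01 psiF phiE t tin tF.
have PF := within_itv_dnbhs_proper t01 tin.
rewrite caputo_primitiveP /derive_in; apply/cvg_lim; first exact: norm_hausdorff.
have primE := caputo_primitiveE al01 psiF phiE.
set c := caputo_cst al in primE *.
apply/cvgrPdist_le => e e0.
have : \forall s \near within `[t0, t1] t^', forall i : 'I_n,
    `|c * psi t 0 i - c * ((s - t)^-1 * (\int[mu]_(r in `[t0, s]) psi r 0 i -
       \int[mu]_(r in `[t0, t]) psi r 0 i))| <= e.
  apply: filter_forall => i.
  have [mpsi [M psiM]] := piecewise_continuous_coord i psiF.
  move: e e0; apply/cvgrPdist_le; apply: cvgMr.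
  apply: (cvg_Rintegral_quotient t01 tin mpsi psiM).
  by apply: cvg_coord; case: psiF => _ _; apply.
rewrite !near_withinE; apply: filterS => s se st sin'.
have sin : t0 <= s <= t1 by move: sin'; rewrite /= in_itv.
rewrite (primE s sin) (primE t tin) opprD addrACA subrr add0r -scalerBr.
apply: rV_norm_le => [|i]; first exact: ltW.
have := se st sin' i; rewrite !mxE.
by rewrite (mulrCA c).
Qed.

Lemma frac_int_left t0 al psi : frac_int t0 al psi t0 = 0.
Proof.
by apply/rowP => i; rewrite !mxE set_itv1 Rintegral_set1 mulr0.
Qed.

Lemma frac_intD t0 t1 al F G psi chi (k : R) t : 0 < al -> t0 <= t <= t1 ->
  piecewise_continuous t0 t1 F psi -> piecewise_continuous t0 t1 G chi ->
  frac_int t0 al (fun s => psi s + k *: chi s) t =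
  frac_int t0 al psi t + k *: frac_int t0 al chi t.
Proof.
move=> al0 /andP[t0t tt1] psiF chiG; apply/rowP => i; rewrite !mxE.
have sub r : r \in `[t0, t] -> r \in `[t0, t1] by rewrite !in_itv/=; lra.
have ik H (f : R -> 'rV[R]_n) : piecewise_continuous t0 t1 H f ->
    mu.-integrable `[t0, t] (fun s => ((t - s) `^ (al - 1) * f s 0 i)%:E).
  move=> fH; have [mf [M fM]] := piecewise_continuous_coord i fH.
  apply: (@integrable_bounded_kernel _ _ _ _ M) => // [|s /sub]; last exact: fM.
  by apply: measurable_funS mf => // s; exact: sub.
have ipsi := ik _ _ psiF; have ichi := ik _ _ chiG.
rewrite (mulrCA k) -(RintegralZl k _ ichi)// -mulrDr; congr (_ * _).
rewrite -RintegralD//; last by apply: (integrableZl _ k ichi).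
by apply: eq_Rintegral => s _; rewrite !mxE mulrDr (mulrCA k).
Qed.

Lemma frac_int0 t0 al t : frac_int t0 al (fun=> 0 : 'rV[R]_n) t = 0.
Proof.
apply/rowP => i; rewrite !mxE (_ : Rintegral _ _ _ = 0) ?mulr0//.
rewrite -[RHS](Rintegral_set0 mu (cst 0)) Rintegral_mkcond [RHS]Rintegral_mkcond.
apply: eq_Rintegral => s _; rewrite !patchE in_set0 mulr0.
by case: ifP.
Qed.

Section Variation.
Variables (t0 t1 al : R).
Hypotheses (t01 : t0 < t1) (al01 : 0 < al <= 1).
Notation c := (caputo_cst al).

Lemma PCalpha_caputo phi : PCalpha t0 t1 al phi ->
  exists2 F, (forall s, s \in F -> t0 < s < t1) &
    piecewise_continuous t0 t1 F (caputo t0 t1 al phi).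
Proof.
move=> [_ [psi [/PC_piecewise_continuous[F Fin psiF] phiE]]].
exists F => //; have capE := caputoE t01 al01 psiF phiE.
apply: (piecewise_continuous_eq capE); split=> t tin.
- by apply: is_cvgZr; case: psiF => fl _ _; exact: fl.
- by apply: is_cvgZr; case: psiF => _ fr _; exact: fr.
- by move=> tF; apply: cvgZr; case: psiF => _ _; apply.
Qed.

Lemma PCalpha_variation G chi phi h : PCalpha t0 t1 al phi ->
  (forall s, s \in G -> t0 < s < t1) -> piecewise_continuous t0 t1 G chi ->
  (forall t, t0 <= t <= t1 -> continuous_at_in t0 t1 h t) ->
  (forall t, t0 <= t <= t1 -> h t = frac_int t0 al chi t) ->
  exists F, [/\ {subset G <= F}, forall s, s \in F -> t0 < s < t1,
    piecewise_continuous t0 t1 F (caputo t0 t1 al phi) &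
    forall k : R, let z t := phi t + k *: h t in
      [/\ PCalpha t0 t1 al z,
          forall t, t0 <= t <= t1 -> t \notin F ->
            caputo t0 t1 al z t = caputo t0 t1 al phi t + k *: (c *: chi t)
        & forall t, t0 <= t <= t1 -> t \notin F ->
            caputo t0 t1 al (z \- phi)%R t = k *: (c *: chi t)]].
Proof.
move=> [phic [psi [/PC_piecewise_continuous[F Fin psiF] phiE]]] Gin chiG hc hE.
have al0 : 0 < al by case/andP: al01.
exists (F ++ G); split.
- by move=> s sG; rewrite mem_cat sG orbT.
- by move=> s; rewrite mem_cat => /orP[/Fin|/Gin].
- have capE := caputoE t01 al01 psiF phiE.
  (* The zero term enlarges the exceptional set from F to F ++ G. *)
  apply: (@piecewise_continuous_eq _ _ _ _ _ (fun t => c *: psi t + 0 *: chi t)).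
    move=> t tin; rewrite mem_cat negb_or => /andP[tF _].
    by rewrite scale0r addr0 capE.
  apply: piecewise_continuousD => //; split=> t tin.
  + by apply: is_cvgZr; case: psiF => fl _ _; exact: fl.
  + by apply: is_cvgZr; case: psiF => _ fr _; exact: fr.
  + by move=> tF; apply: cvgZr; case: psiF => _ _; apply.
move=> k z.
have tt0 : t0 <= t0 <= t1 by rewrite lexx ltW.
have h0 : h t0 = 0 by rewrite hE// frac_int_left.
have zF := piecewise_continuousD k psiF chiG.
have zE t : t0 <= t <= t1 ->
    z t = z t0 + frac_int t0 al (fun s => psi s + k *: chi s) t.
  move=> tin; rewrite (frac_intD _ al0 tin psiF chiG) /z (phiE t tin) (hE t tin) h0.
  by rewrite scaler0 addr0 addrA.
split.
- split; first by move=> t tin; apply: cvgD; [exact: phic|apply: cvgZr; exact: hc].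
  exists (fun s => psi s + k *: chi s); split=> //.
  apply: piecewise_continuous_PC zF.
  by move=> s; rewrite mem_cat => /orP[/Fin|/Gin].
- move=> t tin tFG; rewrite (caputoE t01 al01 zF zE tin tFG).
  rewrite (caputoE t01 al01 psiF phiE tin); last first.
    by move: tFG; rewrite mem_cat negb_or => /andP[].
  by rewrite scalerDr scalerA mulrC -scalerA.
- move=> t tin tFG.
  have zeroG : piecewise_continuous t0 t1 [::] (fun=> 0 : 'rV[R]_n).
    by split=> *; [exact: is_cvg_cst|exact: is_cvg_cst|exact: cvg_cst].
  have kG := piecewise_continuousD k zeroG chiG.
  have zh r : (z \- phi)%R r = k *: h r.
    by rewrite /z /= addrAC subrr add0r.
  have dE s : t0 <= s <= t1 -> (z \- phi)%R s =
      (z \- phi)%R t0 + frac_int t0 al (fun s => 0 + k *: chi s) s.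
    move=> sin; rewrite (frac_intD _ al0 sin zeroG chiG) frac_int0.
    by rewrite !zh h0 scaler0 !add0r (hE s sin).
  rewrite (caputoE t01 al01 kG dE tin); last first.
    by move: tFG; rewrite mem_cat negb_or => /andP[].
  by rewrite add0r scalerA mulrC -scalerA.
Qed.

End Variation.

End CaputoOfFractionalIntegral.

(** * A uniform neighborhood of the graph *)

Section GraphNeighborhood.
Context {R : realType} {n : nat}.
Variables (t0 t1 al : R) (x : R -> 'rV[R]_n).
Variable L : R -> 'rV[R]_n -> 'rV[R]_n -> R.
Hypotheses (t01 : t0 < t1).
Notation D := (caputo t0 t1 al x).
Notation graph := (graph_caputo t0 t1 al x).
Variable F : seq R.
Hypothesis Fin : forall s, s \in F -> t0 < s < t1.
Hypothesis DF : piecewise_continuous t0 t1 F D.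
Implicit Types (t s r : R) (u v y d : 'rV[R]_n).

Lemma graph_off t : t0 <= t <= t1 -> t \notin F -> graph (t, x t, D t).
Proof.
move=> tin tF; left; exists t => //; split; first by rewrite /= in_itv.
case=> t01t [_ _ []]; apply/(continuous_at_in_interior _ t01t).
by case: DF => _ _; apply.
Qed.

(** At a corner this is part of the definition of the graph. At a non-corner point of F both
    one-sided limits exist, so only continuity of D is left; then the limit is [D t]. *)
Lemma graph_left t : t0 < t <= t1 -> graph (t, x t, lim (D @ t^'-)).
Proof.
move=> tin; have tin' : t0 <= t <= t1 by case/andP: tin => /ltW -> ->.
case: (DF) => Dl Dr Dc.
have [|nA] := pselect (corner_points t0 t1 al x t); first by right; left; exists t.
suff DE : D @ t^'- --> D t.
  rewrite (cvg_lim _ DE); last exact: norm_hausdorff.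
  by left; exists t => //; split=> //; rewrite /= in_itv.
have [tF|tF] := boolP (t \in F); last first.
  by apply: (continuous_at_in_left tin); apply: Dc.
have tin2 := Fin tF; apply: cvg_at_left_filter.
apply: contrapT => nD; apply: nA; split=> //; split=> //; first exact: Dl.
by apply: Dr; case/andP: tin2 => /ltW -> ->.
Qed.

Lemma graph_right t : t0 <= t < t1 -> graph (t, x t, lim (D @ t^'+)).
Proof.
move=> tin; have tin' : t0 <= t <= t1 by case/andP: tin => -> /ltW ->.
case: (DF) => Dl Dr Dc.
have [|nA] := pselect (corner_points t0 t1 al x t); first by right; right; exists t.
suff DE : D @ t^'+ --> D t.
  rewrite (cvg_lim _ DE); last exact: norm_hausdorff.
  by left; exists t => //; split=> //; rewrite /= in_itv.
have [tF|tF] := boolP (t \in F); last first.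
  by apply: (continuous_at_in_right tin); apply: Dc.
have tin2 := Fin tF; apply: cvg_at_right_filter.
apply: contrapT => nD; apply: nA; split=> //; split=> //; last exact: Dr.
by apply: Dl; case/andP: tin2 => -> /ltW ->.
Qed.

Hypothesis xc : forall t, t0 <= t <= t1 -> continuous_at_in t0 t1 x t.
Variable U : set (R * 'rV[R]_n * 'rV[R]_n).
Hypotheses (oU : open U) (gU : graph `<=` U).
Hypothesis UL : forall t y d, U (t, y, d) ->
  {for (t, y, d), continuous (fun p => L p.1.1 p.1.2 p.2)} /\
  {for (t, y, d), continuous (fun p => grad_x L p.1.1 p.1.2 p.2)}.

(* One parameter r serves as radius and, through r^-1, as bound, so that a
   single compactness argument near 0^'+ yields both. *)
Let good r s := forall u v, `|u| <= r -> `|v| <= r ->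
  [/\ U (s, x s + u, D s + v), `|L s (x s + u) (D s + v)| <= r^-1
    & `|grad_x L s (x s + u) (D s + v)| <= r^-1].

Let good_near t y d : U (t, y, d) -> exists2 e, 0 < e &
  forall r s, `|t - s| < e -> `|y - x s| < e -> `|d - D s| < e -> 0 < r < e ->
  good r s.
Proof.
move=> Utyd; have [Lc gc] := UL Utyd.
have := open_nbhs_nbhs (conj oU Utyd).
move/cvgrPdist_lt/(_ 1 ltr01) : gc => gc.
move/cvgrPdist_lt/(_ 1 ltr01) : Lc => Lc Un.
have /nbhs_ballP[e /= e0 eH] : \forall p \near (t, y, d), U p /\
    (`|L t y d - L p.1.1 p.1.2 p.2| < 1 /\
     `|grad_x L t y d - grad_x L p.1.1 p.1.2 p.2| < 1).
  by apply: filterI => //; exact: filterI.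
(* By continuity K bounds L and its x-gradient on the ball, and r < K^-1 turns it into the bound
   r^-1. Half of the ball's radius serves the approximation of the graph point, half the
   displacement. *)
pose K := `|L t y d| + `|grad_x L t y d| + 1.
have K0 : 0 < K by rewrite ltr_wpDl// addr_ge0.
exists (Num.min (e / 2) K^-1).
  by rewrite lt_min divr_gt0//= invr_gt0.
move=> r s; rewrite !lt_min => /andP[ts _] /andP[ys _] /andP[ds _].
case/and3P => r0 re rK u v ur vr.
have e2 : e / 2 < e by rewrite ltr_pdivrMr// ltr_pMr// ltr1n.
have /eH[/= Us [Ls gs]] : ball (t, y, d) e (s, x s + u, D s + v).
  split; [split|]; rewrite -ball_normE/=.
  - exact: lt_trans e2.
  - rewrite opprD addrA; apply: le_lt_trans (ler_normB _ _) _.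
    by rewrite (splitr e) ltrD// (le_lt_trans ur).
  - rewrite opprD addrA; apply: le_lt_trans (ler_normB _ _) _.
    by rewrite (splitr e) ltrD// (le_lt_trans vr).
have Kr : K <= r^-1 by rewrite -[K]invrK lef_pV2 ?posrE ?invr_gt0// ltW.
split=> //.
- apply: le_trans Kr; rewrite -(subrK (L t y d) (L s _ _)).
  apply: le_trans (ler_normD _ _) _; rewrite distrC.
  by have := normr_ge0 (grad_x L t y d); rewrite /K; lra.
- apply: le_trans Kr; rewrite -(subrK (grad_x L t y d) (grad_x L s _ _)).
  apply: le_trans (ler_normD _ _) _; rewrite distrC.
  by have := normr_ge0 (L t y d); rewrite /K; lra.
Qed.

(** This tube makes the Lagrangian bounded along x and along nearby curves, so both values of J are
    genuine integrals, and it bounds the effect of h through L_x. The covering passes across jumps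
    because both one-sided limits lie in the graph. *)
Lemma graph_neighborhood : exists2 r, 0 < r &
  forall s, t0 <= s <= t1 -> s \notin F -> forall u v, `|u| <= r -> `|v| <= r ->
  [/\ U (s, x s + u, D s + v), `|L s (x s + u) (D s + v)| <= r^-1
    & `|grad_x L s (x s + u) (D s + v)| <= r^-1].
Proof.
have loc (G : set_system R) (FG : Filter G) t y d : U (t, y, d) ->
    id @ G --> t -> x @ G --> y -> D @ G --> d ->
    \forall s \near G & r \near 0^'+, good r s.
  move=> Utyd Gt Gy Gd; have [e e0 eH] := good_near Utyd.
  exists ([set s | [/\ `|t - s| < e, `|y - x s| < e & `|d - D s| < e]],
          [set r | 0 < r < e]); last first.
    by move=> [s r] /= [[ts ys ds] re]; exact: eH.
  split=> /=.
    move/cvgrPdist_lt : Gt => /(_ e e0) Gt.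
    move/cvgrPdist_lt : Gy => /(_ e e0) Gy.
    move/cvgrPdist_lt : Gd => /(_ e e0) Gd.
    by near=> s; split; near: s.
  near=> r; apply/andP; split; near: r; first exact: nbhs_right_gt.
  exact: nbhs_right_lt.
have [Dl Dr _] := DF.
have cov : \forall r \near 0^'+, forall s, t0 <= s <= t1 -> s \notin F -> good r s.
  apply: near_covering_sides => t tin.
  - apply: loc (gU (graph_left tin)) _ _ _; last exact: Dl.
      exact/cvg_at_left_filter/cvg_id.
    apply: (continuous_at_in_left tin); apply: xc.
    by case/andP: tin => /ltW -> ->.
  - apply: loc (gU (graph_right tin)) _ _ _; last exact: Dr.
      exact/cvg_at_right_filter/cvg_id.
    apply: (continuous_at_in_right tin); apply: xc.
    by case/andP: tin => -> /ltW ->.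
  - move=> tF; have [e e0 eH] := good_near (gU (graph_off tin tF)).
    near=> r; apply: eH; rewrite ?subrr ?normr0//.
    apply/andP; split; near: r; first exact: nbhs_right_gt.
    exact: nbhs_right_lt.
near (0 : R)^'+ => r; exists r => //.
by move=> s sin sF; apply: (near cov r).
Unshelve. all: by end_near. Qed.

End GraphNeighborhood.

(** * Needles *)

Section TruncatedPower.
Context {R : realType}.
Notation mu := (@lebesgue_measure R).
Implicit Types (a t s u e g : R).

(** Truncated power: [tpow g (t - a)] is Gamma(g) times the fractional integral of order g of the
    unit step at a. *)
Definition tpow g u : R := Num.max u 0 `^ g / g.

Lemma tpow_le0 g u : 0 < g -> u <= 0 -> tpow g u = 0.
Proof. by move=> g0 u0; rewrite /tpow max_r// powR0 ?gt_eqF// mul0r. Qed.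

Lemma tpow_ge0E g u : 0 <= u -> tpow g u = u `^ g / g.
Proof. by move=> u0; rewrite /tpow max_l. Qed.

Lemma le_tpow g : 0 < g -> {homo tpow g : u v / u <= v}.
Proof.
move=> g0 u v uv; rewrite /tpow ler_pM2r ?invr_gt0//.
apply: ge0_ler_powR; [exact: ltW| | |by rewrite ge_max !le_max uv lexx orbT];
  by rewrite nnegrE le_max lexx orbT.
Qed.

Lemma tpow_derive g u : 0 < g -> 0 < u -> is_derive u 1 (tpow g) (u `^ (g - 1)).
Proof.
move=> g0 u0.
apply: (@near_eq_is_derive _ _ _ (g^-1 \*: (@powR R ^~ g))) => //.
  near=> v; rewrite tpow_ge0E/=; first by rewrite /GRing.scale/= mulrC.
  by apply: ltW; near: v; exact: lt_nbhsr.
have := is_derive1_powR g u0 => d.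
by apply: is_derive_eq; rewrite /GRing.scale/= mulKf ?gt_eqF.
Unshelve. all: by end_near. Qed.

Lemma tpow_continuous g : 0 < g -> continuous (tpow g).
Proof.
move=> g0 u; have [u0|u0|->] := ltgtP u 0.
- have /near_eq_cvg/cvg_trans : {near u, (fun=> tpow g u) =1 tpow g}.
    near=> v; rewrite /= !tpow_le0 ?ltW//; near: v; exact: lt_nbhsl.
  by apply; exact: cvg_cst.
- apply: differentiable_continuous; apply/derivable1_diffP.
  by have [] := tpow_derive g0 u0.
- apply/left_right_continuousP; rewrite tpow_le0//; split.
    have /near_eq_cvg/cvg_trans : {near 0^'-, (fun=> 0) =1 tpow g}.
      near=> v; rewrite /= tpow_le0//; near: v; exact: nbhs_left_le.
    by apply; exact: cvg_cst.
  have /near_eq_cvg/cvg_trans : {near 0^'+, (fun a => a `^ g * g^-1) =1 tpow g}.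
    near=> v; rewrite tpow_ge0E//; near: v; exact: nbhs_right_ge.
  by apply; have := cvgMl (b := g^-1) (powR_cvg0 g0); rewrite mul0r; exact.
Unshelve. all: by end_near. Qed.

Let tpow_quotient g u : 0 < g -> 0 < u ->
  h^-1 * (tpow g (u + h) - tpow g u) @[h --> 0^'] --> u `^ (g - 1).
Proof.
move=> g0 u0; have [dP <-] := tpow_derive g0 u0.
suff -> : (fun h => h^-1 * (tpow g (u + h) - tpow g u)) =
    (fun h : R => h^-1 *: (tpow g (h *: (1 : R) + u) - tpow g u)) by exact: dP.
by apply/funext => h; rewrite /GRing.scale/= mulr1 (addrC h).
Qed.

Lemma tpow_quotient_right g u : 0 < g -> 0 < u ->
  (tpow g (u + e) - tpow g u) / e @[e --> 0^'+] --> u `^ (g - 1).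
Proof.
move=> g0 u0; have /cvg_dnbhs_at_right := tpow_quotient g0 u0.
by under eq_fun do rewrite mulrC.
Qed.

Lemma tpow_quotient_left g u : 0 < g -> 0 < u ->
  (tpow g u - tpow g (u - e)) / e @[e --> 0^'+] --> u `^ (g - 1).
Proof.
move=> g0 u0; have /cvg_dnbhs_at_left/cvg_at_leftNP := tpow_quotient g0 u0.
rewrite oppr0; suff -> : (fun e => (tpow g u - tpow g (u - e)) / e) =
    (fun h => h^-1 * (tpow g (u + h) - tpow g u)) \o -%R by [].
by apply/funext => e; rewrite /= invrN mulNr -mulrN opprB mulrC.
Qed.

Let powR_antitone g u v : g <= 1 -> 0 < u -> u <= v -> v `^ (g - 1) <= u `^ (g - 1).
Proof.
move=> g1 u0 uv; have v0 := lt_le_trans u0 uv.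
rewrite -[g - 1]opprK !(powRN _ (- _)) lef_pV2 ?posrE ?powR_gt0//.
by apply: ge0_ler_powR; rewrite ?nnegrE//; lra.
Qed.

(** A bound uniform in e, singular at 0 but integrable. For u > 0 it is (1 + s)^g <= 1 + s with s =
    e / u. For u < 0 < u + e, the quotient is at most e^(g-1) / g, and |u| < e. *)
Lemma tpow_quotient_right_le g u e : 0 < g <= 1 -> u != 0 -> 0 < e ->
  0 <= (tpow g (u + e) - tpow g u) / e <= `|u| `^ (g - 1) / g.
Proof.
move=> /andP[g0 g1] u0 e0; rewrite divr_ge0 ?(ltW e0)//=; last first.
  by rewrite subr_ge0 le_tpow// lerDl ltW.
move: u0; rewrite neq_lt => /orP[u0|u0].
  rewrite (tpow_le0 g0 (ltW u0)) subr0 ltr0_norm//.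
  have [ue0|ue0] := leP (u + e) 0.
    by rewrite tpow_le0// mul0r divr_ge0 ?powR_ge0 ?(ltW g0).
  rewrite tpow_ge0E ?(ltW ue0)// mulrAC ler_pM2r ?invr_gt0// ler_pdivrMr//.
  apply: (@le_trans _ _ (e `^ g)).
    by apply: ge0_ler_powR; rewrite ?nnegrE//; lra.
  by rewrite -(mulr_powRB1 (ltW e0) g0) mulrC ler_pM2r// powR_antitone//; lra.
rewrite !tpow_ge0E ?addr_ge0 ?(ltW u0) ?(ltW e0)// gtr0_norm// -mulrBl mulrAC ler_pM2r ?invr_gt0//.
rewrite ler_pdivrMr//.
have -> : u + e = u * (1 + e / u) by field; rewrite gt_eqF.
have s0 : 0 <= e / u by rewrite divr_ge0 ?(ltW u0) ?(ltW e0).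
rewrite powRM ?(ltW u0)//; last by lra.
apply: (@le_trans _ _ (u `^ g * (1 + e / u) - u `^ g)).
  by rewrite lerB// ler_pM2l ?powR_gt0// ler1_powR//; lra.
by rewrite -(mulr_powRB1 (ltW u0) g0) le_eqVlt; apply/orP; left; apply/eqP; field; rewrite gt_eqF.
Qed.

(** For u > e it is (1 - s)^g >= 1 - s with s = e / u; for 0 < u <= e the subtracted term vanishes
    and 1 / e <= 1 / u. *)
Lemma tpow_quotient_left_le g u e : 0 < g <= 1 -> u != 0 -> 0 < e ->
  0 <= (tpow g u - tpow g (u - e)) / e <= `|u| `^ (g - 1) / g.
Proof.
move=> /andP[g0 g1] u0 e0; rewrite divr_ge0 ?(ltW e0)//=; last first.
  by rewrite subr_ge0 le_tpow// gerBl ltW.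
move: u0; rewrite neq_lt => /orP[u0|u0].
  rewrite !tpow_le0 ?subr0 ?mul0r//; last 2 first.
  - by lra.
  - exact: ltW.
  by rewrite divr_ge0 ?powR_ge0 ?(ltW g0).
rewrite gtr0_norm// tpow_ge0E ?(ltW u0)//.
have [eu|ue] := leP u e.
  rewrite tpow_le0 ?subr_le0// subr0 mulrAC ler_pM2r ?invr_gt0//.
  rewrite ler_pdivrMr// -(mulr_powRB1 (ltW u0) g0) mulrC.
  by rewrite ler_wpM2l ?powR_ge0.
rewrite tpow_ge0E ?subr_ge0 ?(ltW ue)// -mulrBl mulrAC ler_pM2r ?invr_gt0//.
rewrite ler_pdivrMr//.
have -> : u - e = u * (1 - e / u) by field; rewrite gt_eqF.
have s0 : 0 <= e / u by rewrite divr_ge0 ?(ltW u0) ?(ltW e0).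
have s1 : e / u < 1 by rewrite ltr_pdivrMr// mul1r.
rewrite powRM ?(ltW u0)//; last by lra.
apply: (@le_trans _ _ (u `^ g - u `^ g * (1 - e / u))).
  by rewrite lerB// ler_pM2l ?powR_gt0// ger1_powR//; lra.
by rewrite -(mulr_powRB1 (ltW u0) g0) le_eqVlt; apply/orP; left; apply/eqP; field; rewrite gt_eqF.
Qed.

Lemma Rintegral_kernel_step t0 t a g : 0 < g -> t0 <= a -> t0 <= t ->
  \int[mu]_(s in `[t0, t]) ((t - s) `^ (g - 1) * (a <= s)%R%:R) = tpow g (t - a).
Proof.
move=> g0 t0a t0t; have [ta|a_t] := ltP t a.
  rewrite tpow_le0; [|by []|by rewrite subr_le0 ltW].
  transitivity (\int[mu]_(s in `[t0, t]) (0 * s)).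
    apply: eq_Rintegral => s; rewrite mem_setE in_itv/= => /andP[_ st].
    by rewrite leNgt (le_lt_trans st ta) mulr0 mul0r.
  rewrite /Rintegral (eq_integral (cst 0%E)) ?integral0//.
  by move=> s _; rewrite mul0r.
transitivity (\int[mu]_(s in `[a, t]) ((t - s) `^ (g - 1))).
  rewrite Rintegral_mkcond [RHS]Rintegral_mkcond; apply: eq_Rintegral => s _.
  rewrite !patchE !mem_setE !in_itv/=.
  have [as_|sa] := leP a s; first by rewrite (le_trans t0a as_)/= mulr1.
  by rewrite mulr0; case: ifP.
by rewrite /Rintegral integral_kernel// tpow_ge0E ?subr_ge0.
Qed.

End TruncatedPower.

Section Needle.
Context {R : realType}.
Notation mu := (@lebesgue_measure R).
Implicit Types (t s u e k g tau : R).

Definition step a s : R := (a <= s)%R%:R.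

(* The value of k for which the needle vanishes at tau + T. *)
Definition needle_coef g T e : R :=
  (tpow g (T + e) - tpow g T) / (tpow g T - tpow g (T - e)).

(* Gamma(g) times the fractional integral of [needle_density tau k e]. *)
Definition needle g tau k e t : R :=
  tpow g (t - (tau - e)) - (1 + k) * tpow g (t - tau) +
  k * tpow g (t - (tau + e)).

Lemma piecewise_continuous_step {V : normedModType R} t0 t1 a (v : V) :
  piecewise_continuous t0 t1 [:: a] (fun s => step a s *: v).
Proof.
have stepL t : t <= a -> {near t^'-, (fun=> 0 : V) =1 (fun s => step a s *: v)}.
  move=> ta; near=> s; rewrite /step leNgt (_ : s < a) ?scale0r//.
  by apply: lt_le_trans ta; near: s; exact: nbhs_left_lt.
have stepR t : a <= t -> {near t^'+, (fun=> v) =1 (fun s => step a s *: v)}.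
  move=> ta; near=> s; rewrite /step (_ : a <= s) ?scale1r//.
  by apply: le_trans ta _; near: s; exact: nbhs_right_ge.
have stepl t : t < a -> {near t, (fun=> 0 : V) =1 (fun s => step a s *: v)}.
  move=> ta; near=> s; rewrite /step leNgt (_ : s < a) ?scale0r//.
  by near: s; exact: lt_nbhsl.
have stepr t : a < t -> {near t, (fun=> v) =1 (fun s => step a s *: v)}.
  move=> ta; near=> s; rewrite /step (_ : a <= s) ?scale1r//.
  by apply: ltW; near: s; exact: lt_nbhsr.
have cL t : t < a -> (step a s *: v) @[s --> t] --> (0 : V).
  by move=> ta; apply: cvg_trans (near_eq_cvg (stepl t ta)) _; exact: cvg_cst.
have cR t : a < t -> (step a s *: v) @[s --> t] --> v.
  by move=> ta; apply: cvg_trans (near_eq_cvg (stepr t ta)) _; exact: cvg_cst.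
split=> t tin.
- apply/cvg_ex; have [ta|a_t] := leP t a; last by exists v; exact/cvg_at_left_filter/cR.
  by exists 0; apply: cvg_trans (near_eq_cvg (stepL t ta)) _; exact: cvg_cst.
- apply/cvg_ex; have [ta|a_t] := ltP t a; first by exists 0; exact/cvg_at_right_filter/cL.
  by exists v; apply: cvg_trans (near_eq_cvg (stepR t a_t)) _; exact: cvg_cst.
- rewrite inE => ta; rewrite /continuous_at_in; apply: cvg_trans (cvg_app _ (cvg_within _)) _.
  move: ta; rewrite neq_lt => /orP[ta|a_t].
    by rewrite /step leNgt ta scale0r; exact: cL.
  by rewrite {2}/step ltW// scale1r; exact: cR.
Unshelve. all: by end_near. Qed.

(** A forward difference minus k times a backward difference at t - tau, the two quotients already
    bounded. *)
Lemma needleE g tau k e t : needle g tau k e t =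
  (tpow g (t - tau + e) - tpow g (t - tau)) -
  k * (tpow g (t - tau) - tpow g (t - tau - e)).
Proof.
rewrite /needle opprB addrA (addrAC t) opprD addrA; ring.
Qed.

Lemma needle_continuous g tau k e : 0 < g -> continuous (needle g tau k e).
Proof.
move=> g0 t.
have tc a : tpow g (s - a) @[s --> t] --> tpow g (t - a).
  apply: (@continuous_comp _ _ _ (fun s : R => s - a) (tpow g)); last exact: tpow_continuous.
  by apply: cvgB; [exact: cvg_id|exact: cvg_cst].
apply: cvgD; last by apply: cvgM; [exact: cvg_cst|exact: tc].
by apply: cvgB; [exact: tc|apply: cvgM; [exact: cvg_cst|exact: tc]].
Qed.

Lemma needle_left g tau k e t : 0 < g -> 0 < e -> t <= tau - e -> needle g tau k e t = 0.
Proof. by move=> g0 e0 te; rewrite needleE !tpow_le0//; [ring|lra|lra|lra]. Qed.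

Lemma measurable_step t0 t a : measurable_fun `[t0, t] (step a).
Proof.
apply: (@measurable_fun_piecewise_continuous _ _ _ [:: a]) => s tin sa.
have [_ _ /(_ s)] := @piecewise_continuous_step R^o t0 t a 1.
have tin' : t0 <= s <= t by case/andP: tin => /ltW -> /ltW ->.
move=> /(_ tin' sa) /(continuous_at_in_interior _ tin).
suff -> : (fun s => step a s *: (1 : R^o)) = step a by [].
by apply/funext => r; rewrite /GRing.scale/= mulr1.
Qed.

Lemma norm_step_le a s : `|step a s| <= 1.
Proof. by rewrite /step; case: (a <= s); rewrite ?normr1 ?normr0. Qed.

Definition needle_density tau k e s : R :=
  step (tau - e) s - (1 + k) * step tau s + k * step (tau + e) s.

Lemma Rintegral_needle g tau k e t0 t : 0 < g -> 0 < e -> t0 <= tau - e -> t0 <= t ->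
  mu.-integrable `[t0, t]
    (EFin \o (fun s => (t - s) `^ (g - 1) * needle_density tau k e s)) /\
  \int[mu]_(s in `[t0, t]) ((t - s) `^ (g - 1) * needle_density tau k e s) =
  needle g tau k e t.
Proof.
move=> g0 e0 t0e t0t; rewrite /needle_density.
have istep a : mu.-integrable `[t0, t] (fun s => ((t - s) `^ (g - 1) * step a s)%:E).
  apply: (@integrable_bounded_kernel _ _ _ _ 1) => //.
    exact: measurable_step.
  by move=> s _; exact: norm_step_le.
have -> : needle g tau k e t =
    \int[mu]_(s in `[t0, t]) ((t - s) `^ (g - 1) * step (tau - e) s) -
    (1 + k) * \int[mu]_(s in `[t0, t]) ((t - s) `^ (g - 1) * step tau s) +
    k * \int[mu]_(s in `[t0, t]) ((t - s) `^ (g - 1) * step (tau + e) s).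
  by rewrite /step !Rintegral_kernel_step//; lra.
have istepZ c a : mu.-integrable `[t0, t]
    (EFin \o (fun s => c * ((t - s) `^ (g - 1) * step a s))).
  exact: (integrableZl _ c (istep a)).
have istepB := integrableB _ (istep (tau - e)) (istepZ (1 + k) tau).
split.
  apply: eq_integrable (integrableD _ (istepB _) (istepZ k (tau + e))) => // s _.
  by rewrite /= -EFinB -EFinD; congr EFin; ring.
rewrite -(RintegralZl (1 + k) _ (istep tau))// -(RintegralZl k _ (istep (tau + e)))//.
rewrite -(RintegralB _ (istep (tau - e)) (istepZ (1 + k) tau))//.
rewrite -(RintegralD _ (istepB _) (istepZ k (tau + e)))//.
by apply: eq_Rintegral => s _; ring.
Qed.

Lemma Rintegral_step t0 t a : t0 <= a <= t ->
  mu.-integrable `[t0, t] (EFin \o step a) /\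
  \int[mu]_(s in `[t0, t]) step a s = t - a.
Proof.
move=> /andP[t0a a_t]; have t0t := le_trans t0a a_t.
have E : (fun s => (t - s) `^ (1 - 1) * step a s) = step a.
  by apply/funext => s; rewrite subrr powRr0 mul1r.
have := @Rintegral_kernel_step _ t0 t a 1 ltr01 t0a t0t.
rewrite -/(step a _) E tpow_ge0E ?subr_ge0// powRr1 ?subr_ge0// divr1 => ->.
split=> //; apply: (@integrable_bounded _ _ _ 1).
  exact: measurable_step.
by move=> s _; exact: norm_step_le.
Qed.

(** With T = t1 - tau this is the vanishing of the needle at t1, hence admissibility. The
    denominator is nonzero because [tpow] increases strictly there. *)
Lemma needle_coefP g T e : 0 < g -> 0 < T -> 0 < e < T ->
  (tpow g (T + e) - tpow g T) - needle_coef g T e * (tpow g T - tpow g (T - e)) = 0.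
Proof.
move=> g0 T0 /andP[e0 eT]; rewrite /needle_coef mulfVK ?subrr// subr_eq0 gt_eqF//.
rewrite !tpow_ge0E ?subr_ge0 ?ltW// ltr_pM2r ?invr_gt0//.
by apply: gt0_ltr_powR => //; rewrite ?nnegrE; lra.
Qed.

Lemma cvg_needle_coef g T : 0 < g -> 0 < T -> needle_coef g T e @[e --> 0^'+] --> (1 : R).
Proof.
move=> g0 T0.
have P0 : T `^ (g - 1) != 0 by rewrite gt_eqF// powR_gt0.
have /near_eq_cvg/cvg_trans : {near 0^'+, (fun e => ((tpow g (T + e) - tpow g T) / e) /
    ((tpow g T - tpow g (T - e)) / e)) =1 needle_coef g T}.
  near=> e; have e0 : 0 < e by near: e; exact: nbhs_right_gt.
  by rewrite /needle_coef invf_div mulrA mulfVK ?gt_eqF.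
apply; rewrite -(divff P0); apply: cvgM; first exact: tpow_quotient_right.
by apply: cvgV => //; exact: tpow_quotient_left.
Unshelve. all: by end_near. Qed.

(** To the right of tau both difference quotients tend to the same derivative and the coefficient
    tends to 1, so they cancel; to the left the needle is eventually 0. *)
Lemma cvg_needle g tau T t : 0 < g -> 0 < T -> t != tau ->
  needle g tau (needle_coef g T e) e t / e @[e --> 0^'+] --> (0 : R).
Proof.
move=> g0 T0; rewrite -subr_eq0; set u := t - tau => u0.
have -> : (fun e => needle g tau (needle_coef g T e) e t / e) =
    (fun e => (tpow g (u + e) - tpow g u) / e -
       needle_coef g T e * ((tpow g u - tpow g (u - e)) / e)).
  by apply/funext => e; rewrite needleE mulrBl mulrA.
move: u0; rewrite neq_lt => /orP[u0|u0].
  have /near_eq_cvg/cvg_trans : {near 0^'+, (fun=> 0) =1 (fun e =>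
      (tpow g (u + e) - tpow g u) / e -
       needle_coef g T e * ((tpow g u - tpow g (u - e)) / e))}.
    near=> e; have e0 : 0 < e by near: e; exact: nbhs_right_gt.
    rewrite !tpow_le0//; [ring|lra|lra|].
    have : e < - u by near: e; apply: nbhs_right_lt; rewrite oppr_gt0.
    by lra.
  by apply; exact: cvg_cst.
rewrite [X in _ --> X](_ : 0 = u `^ (g - 1) - 1 * u `^ (g - 1)); last by ring.
apply: cvgB; first exact: tpow_quotient_right.
by apply: cvgM; [exact: cvg_needle_coef|exact: tpow_quotient_left].
Unshelve. all: by end_near. Qed.

(** The factor 3 bounds 1 + k. *)
Lemma needle_le g tau k e t : 0 < g <= 1 -> 0 < e -> 0 <= k <= 2 -> t != tau ->
  `|needle g tau k e t / e| <= 3 * (`|t - tau| `^ (g - 1) / g).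
Proof.
move=> g01 e0 k2; rewrite -subr_eq0 => u0; rewrite needleE mulrBl -mulrA.
have := tpow_quotient_right_le g01 u0 e0; have := tpow_quotient_left_le g01 u0 e0.
set A := (tpow _ _ - _) / e; set B := (tpow _ (_ + e) - _) / e; set C := _ / g.
move=> A0 B0; rewrite (le_trans (ler_normB _ _))// ger0_norm; last by lra.
rewrite ger0_norm; last by rewrite mulr_ge0//; lra.
have : k * A <= 2 * C by apply: ler_pM; lra.
lra.
Qed.

End Needle.

(** * Dominated convergence for the weighted needle *)

Section NeedleIntegral.
Context {R : realType}.
Notation mu := (@lebesgue_measure R).
Implicit Types (t s u e k g tau : R).

(** For g < 1, the factor (b + 1 - s)^(-g) is at least (b + 1 - a)^(-g) on [a, b], so a multiple of
    the Abel kernel on [a, b + 1] dominates this power, singular at the left end. *)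
Lemma integrable_powR_right a b g : 0 < g <= 1 -> a < b ->
  mu.-integrable `[a, b] (fun s => ((s - a) `^ (g - 1))%:E).
Proof.
move=> /andP[g0]; rewrite le_eqVlt => /predU1P[->|g1] ab.
  apply: (@integrable_bounded _ _ _ 1).
    rewrite (_ : (fun _ => _) = cst 1); first exact: measurable_cst.
    by apply/funext => r; rewrite subrr powRr0.
  by move=> s _; rewrite subrr powRr0 normr1.
have g01 : 0 < g < 1 by rewrite g0.
have ab1 : a < b + 1 by lra.
have ik : mu.-integrable `[a, b + 1]
    (fun s => ((b + 1 - s) `^ (- g) * (s - a) `^ (g - 1))%:E).
  apply/integrableP; split; first by apply/measurable_EFinP; exact: measurable_abel_kernel.
  under eq_integral do rewrite gee0_abs ?lee_fin ?mulr_ge0 ?powR_ge0//.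
  by rewrite integral_abel_kernel// abel_beta_lty.
have {}ik : mu.-integrable `[a, b]
    (fun s => ((b + 1 - s) `^ (- g) * (s - a) `^ (g - 1))%:E).
  by apply: integrableS ik => // s /=; rewrite !in_itv/=; lra.
apply: le_integrable (integrableZl _ ((b + 1 - a) `^ g) ik) => //.
  apply/measurable_EFinP/measurable_funTS; apply: (measurableT_comp (measurable_powR _)).
  exact: measurable_funB.
move=> s /=; rewrite in_itv/= => sab; rewrite !ger0_norm ?lee_fin ?mulr_ge0 ?powR_ge0//.
rewrite mulrA -[leLHS]mul1r ler_wpM2r ?powR_ge0//.
rewrite powRN ler_pdivlMr ?powR_gt0//; last by lra.
by rewrite mul1r ge0_ler_powR ?nnegrE//; lra.
Qed.

Lemma integrable_powR_abs t0 t1 tau g : 0 < g <= 1 -> t0 < tau < t1 ->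
  mu.-integrable `[t0, t1] (fun s => (`|s - tau| `^ (g - 1))%:E).
Proof.
move=> g01 tin; have g0 : 0 < g by case/andP: g01.
have i1 : mu.-integrable `[t0, t1] ((fun s => ((tau - s) `^ (g - 1))%:E) \_ `[t0, tau]).
  apply/integrable_restrict => //.
  apply: integrableS (integrable_kernel g0 (ltW (proj1 (andP tin)))) => //.
  exact: measurableI.
have i2 : mu.-integrable `[t0, t1] ((fun s => ((s - tau) `^ (g - 1))%:E) \_ `[tau, t1]).
  apply/integrable_restrict => //.
  apply: integrableS (integrable_powR_right g01 (proj2 (andP tin))) => //.
  exact: measurableI.
apply: le_integrable (integrableD _ i1 i2) => //.
  apply/measurable_EFinP/measurable_funTS; apply: (measurableT_comp (measurable_powR _)).
  by apply: measurableT_comp => //; exact: measurable_funB.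
move=> s /=; rewrite in_itv/= => sin; rewrite !patchE !mem_setE !in_itv/=.
rewrite -[point]/(0%E : \bar R); have [st|ts|->] := ltgtP s tau.
- have -> : (t0 <= s) = true by case/andP: sin.
  by rewrite /= addr0 distrC (gtr0_norm (x := tau - s)) ?subr_gt0.
- have -> : (s <= t1) = true by case/andP: sin.
  by rewrite /= andbF /= add0r (gtr0_norm (x := s - tau)) ?subr_gt0.
- have /andP[/ltW -> /ltW ->] := tin.
  rewrite /= subrr normr0 lee_fin !ger0_norm ?addr_ge0 ?powR_ge0//.
  by rewrite lerDl powR_ge0.
Qed.

(** A power is monotone or antitone according to the sign of its exponent; the sum of the end values
    covers both, so beta may lie on either side of 1. *)
Lemma powR_le_sum a b r g : 0 < a -> a <= r -> r <= b -> r `^ g <= a `^ g + b `^ g.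
Proof.
move=> a0 ar rb; have r0 := lt_le_trans a0 ar; have b0 := lt_le_trans r0 rb.
have [g0|g0] := leP 0 g.
  apply: (@le_trans _ _ (b `^ g)); last by rewrite lerDr powR_ge0.
  by apply: ge0_ler_powR; rewrite ?nnegrE// ltW.
apply: (@le_trans _ _ (a `^ g)); last by rewrite lerDl powR_ge0.
rewrite -[g]opprK !(powRN _ (- _)) lef_pV2 ?posrE ?powR_gt0//.
by apply: ge0_ler_powR; rewrite ?nnegrE ?oppr_ge0// ltW.
Qed.

Section Convergence.
Variables (t0 t1 tau g b d : R).
Hypotheses (tin : t0 < tau < t1) (g01 : 0 < g <= 1) (b0 : 0 < b) (d0 : 0 < d).
Let T := t1 - tau.
Notation w t := ((t1 - t) `^ (b - 1)).
Notation coef e := (needle_coef g T e).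
Notation nd e t := (needle g tau (coef e) e t).

(* The product of the two singular weights, at tau and at t1, is bounded by a
   sum of them: each is bounded away from its own singularity. *)
Let dominator t := 3 / g *
  ((((t1 - tau) / 2) `^ (b - 1) + (t1 - t0) `^ (b - 1)) * `|t - tau| `^ (g - 1) +
   (((t1 - tau) / 2) `^ (g - 1) + (t1 - t0) `^ (g - 1)) * w t).

Let integrable_dominator : mu.-integrable `[t0, t1] (EFin \o dominator).
Proof.
have /andP[tin1 tin2] := tin; have t01 : t0 <= t1 by lra.
have i1 := integrable_powR_abs g01 tin; have i2 := integrable_kernel b0 t01.
have j1 := integrableZl _ (((t1 - tau) / 2) `^ (b - 1) + (t1 - t0) `^ (b - 1)) i1.
have j2 := integrableZl _ (((t1 - tau) / 2) `^ (g - 1) + (t1 - t0) `^ (g - 1)) i2.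
have j := integrableD _ (j1 _) (j2 _).
by apply: eq_integrable (integrableZl _ (3 / g) (j _ _ _)).
Qed.

Let needle_dominated e t : 0 < e -> 0 <= coef e <= 2 -> t0 <= t <= t1 -> t != tau ->
  w t * `|nd e t / e| <= dominator t.
Proof.
move=> e0 k2 tint ttau; have /andP[tin1 tin2] := tin; have g0 : 0 < g by case/andP: g01.
apply: le_trans (ler_wpM2l (powR_ge0 _ _) (needle_le g01 e0 k2 ttau)) _.
rewrite /dominator mulrCA.
have -> : 3 * (w t * (`|t - tau| `^ (g - 1) / g)) =
  3 / g * (w t * `|t - tau| `^ (g - 1)) by ring.
rewrite ler_wpM2l ?divr_ge0//; first exact: ltW.
(* Left of the midpoint t1 - t is at least (t1 - tau) / 2; right of it t - tau is. *)
have [tm|mt] := leP t ((tau + t1) / 2).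
  rewrite -[leLHS]addr0 lerD//; last by rewrite mulr_ge0 ?addr_ge0 ?powR_ge0.
  by rewrite ler_wpM2r ?powR_ge0// powR_le_sum//; lra.
rewrite -[leLHS]add0r lerD//; first by rewrite mulr_ge0 ?addr_ge0 ?powR_ge0.
rewrite mulrC ler_wpM2r ?powR_ge0// ger0_norm; last by lra.
by rewrite powR_le_sum//; lra.
Qed.

Lemma needle_small : exists e : nat -> R,
  [/\ forall m, 0 < e m < d,
      forall m, 0 <= coef (e m) <= 2,
      coef (e m) @[m --> \oo] --> (1 : R),
      forall m, mu.-integrable `[t0, t1] (EFin \o (fun t => w t * `|nd (e m) t / e m|)) &
      \int[mu]_(t in `[t0, t1]) (w t * `|nd (e m) t / e m|) @[m --> \oo] --> (0 : R)].
Proof.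
have g0 : 0 < g by case/andP: g01.
have /andP[tin1 tin2] := tin; have T0 : 0 < T by rewrite subr_gt0.
have ck := cvg_needle_coef g0 T0.
have : \forall e \near 0^'+, 0 <= coef e <= 2.
  have /cvgrPdist_le/(_ 1 ltr01) := ck; apply: filterS => e.
  by rewrite ler_norml; lra.
rewrite near_withinE => -[e1 /= e10 ke1].
(* A sequence, as dominated convergence requires; halving keeps e 0 strictly below both d and e1. *)
pose e m := Num.min d e1 / 2 / m.+1%:R.
have m0 : 0 < Num.min d e1 by rewrite lt_min d0.
have e0 m : 0 < e m by rewrite !divr_gt0.
have elt m : e m < Num.min d e1.
  rewrite /e ltr_pdivrMr// ltr_pdivrMr// -mulrA ltr_pMr//.
  by rewrite -natrM ltr1n.
have ecv : e m @[m --> \oo] --> 0^'+.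
  have ecv0 : e m @[m --> \oo] --> (0 : R).
    rewrite -(mulr0 (Num.min d e1 / 2)); apply: cvgM; first exact: cvg_cst.
    exact: cvg_harmonic.
  move=> A [r /= r0 rA]; have /cvgrPdist_lt/(_ r r0) := ecv0.
  apply: filterS => m er; exact: rA.
have k2 m : 0 <= coef (e m) <= 2.
  apply: ke1 => //=; rewrite sub0r normrN gtr0_norm//.
  by have := elt m; rewrite lt_min => /andP[].
have md m : measurable_fun `[t0, t1] (fun t => w t * `|nd (e m) t / e m|).
  apply: measurable_funM; first exact: measurable_kernel.
  apply: measurableT_comp => //; apply: measurable_funM => //.
  by apply: measurable_funTS; apply: continuous_measurable_fun; exact: needle_continuous.
exists e; split => //.
- by move=> m; rewrite e0; have := elt m; rewrite lt_min => /andP[].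
- exact: (cvg_comp _ _ ecv ck).
(* The point tau is removed, since the bound on the needle is available only off tau. *)
- move=> m; have mN : measurable ([set tau] : set (measurableTypeR R)).
    exact: measurable_set1.
  rewrite (negligible_integrable mN)//; last 2 first.
  + by apply/measurable_EFinP; exact: md.
  + exact: lebesgue_measure_set1.
  apply: le_integrable (integrableS _ _ _ integrable_dominator) => //.
  + exact: measurableD.
  + by apply/measurable_EFinP; apply: measurable_funS (md m) => //; exact: subDsetl.
  + move=> t [] /=; rewrite in_itv/= => tint /eqP ttau.
    rewrite lee_fin ger0_norm ?mulr_ge0 ?powR_ge0//.
    by rewrite (le_trans (needle_dominated (e0 m) (k2 m) tint ttau))// ler_norm.
  + exact: measurableD.
- have off (P : R -> Prop) : (forall t, t != tau -> P t) -> {ae mu, forall t, P t}.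
    move=> Pt; exists [set tau]; split; [exact: measurable_set1|exact: lebesgue_measure_set1|].
    by move=> t /= nPt; apply: contrapT => /eqP ttau; apply: nPt; exact: Pt.
  have [] := @dominated_convergence _ _ R mu `[t0, t1] (measurable_itv _)
    (fun m t => (w t * `|nd (e m) t / e m|)%:E) (cst 0%E) (EFin \o dominator).
  + by move=> m; apply/measurable_EFinP; exact: md.
  + exact: measurable_cst.
  + apply: off => t ttau tint; apply: cvg_EFin; first exact: nearW.
    rewrite -(mulr0 (w t)); apply: cvgM; first exact: cvg_cst.
    rewrite -(normr0 R); apply: cvg_norm.
    exact: (cvg_comp _ _ ecv (cvg_needle g0 T0 ttau)).
  + exact: integrable_dominator.
  + apply: off => t ttau m; rewrite /= in_itv/= => tint.
    rewrite lee_fin ger0_norm ?mulr_ge0 ?powR_ge0//.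
    exact: needle_dominated (e0 m) (k2 m) tint ttau.
  move=> _ _; rewrite integral0; exact: fine_cvg.
Qed.

End Convergence.
End NeedleIntegral.

(** * The first-order inequality *)

Section Directional.
Context {R : realType} {n : nat}.
Implicit Types (f : 'rV[R]_n -> R) (u v : 'rV[R]_n) (q : R).

Lemma derive_line f u v q : derivable f (u + q *: v) v ->
  is_derive q 1 (fun p => f (u + p *: v)) ('D_v f (u + q *: v)).
Proof.
move=> df.
have E : (fun h : R => h^-1 *: (f (u + (h *: (1 : R) + q) *: v) - f (u + q *: v))) =
    (fun h => h^-1 *: (f (h *: v + (u + q *: v)) - f (u + q *: v))).
  apply/funext => h; congr (_ *: (f _ - _)).
  by rewrite scalerDl /GRing.scale/= mulr1 addrCA.
split; first by rewrite /derivable E.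
by rewrite /derive E.
Qed.

(** The hypotheses give partial derivatives only, so increments are taken along one coordinate line;
    q may have either sign. *)
Lemma MVT_line f u v q :
  (forall p, `|p| <= `|q| -> derivable f (u + p *: v) v) ->
  exists2 p, `|p| <= `|q| & f (u + q *: v) - f u = q * 'D_v f (u + p *: v).
Proof.
move=> df; pose g p := f (u + p *: v).
have dg (p : R) : `|p| <= `|q| -> is_derive p 1 g ('D_v f (u + p *: v)).
  by move=> pq; apply: derive_line; exact: df.
have cg (a b : R) : (forall p, p \in `[a, b] -> `|p| <= `|q|) ->
    {within `[a, b], continuous g}.
  move=> ab; apply: continuous_in_subspaceT => p; rewrite inE/= => pab.
  apply: differentiable_continuous; apply/derivable1_diffP.
  by have [] := dg p (ab p pab).
have g0 : g 0 = f u by rewrite /g scale0r addr0.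
have [q0|q0] := leP 0 q.
  have [||p pq gE] := @MVT_segment R g (fun p => 'D_v f (u + p *: v)) 0 q q0.
  - by move=> p; rewrite in_itv/= => pq; apply: dg; rewrite !ger0_norm//; lra.
  - by apply: cg => p; rewrite in_itv/= => pq; rewrite !ger0_norm//; lra.
  exists p; first by move: pq; rewrite in_itv/= => pq; rewrite !ger0_norm//; lra.
  by rewrite -g0 -/(g q) gE subr0 mulrC.
have [||p pq gE] := @MVT_segment R g (fun p => 'D_v f (u + p *: v)) q 0 (ltW q0).
- by move=> p; rewrite in_itv/= => pq; apply: dg; rewrite !ler0_norm//; lra.
- by apply: cg => p; rewrite in_itv/= => pq; rewrite !ler0_norm//; lra.
exists p; first by move: pq; rewrite in_itv/= => pq; rewrite !ler0_norm//; lra.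
by rewrite -g0 -/(g q) -opprB gE sub0r mulrN opprK mulrC.
Qed.

Lemma norm_delta_le (i : 'I_n) q : `|q *: delta_mx 0 i : 'rV[R]_n| <= `|q|.
Proof.
apply: rV_norm_le => // j; rewrite !mxE normrM ler_piMr//.
by case: (_ && _); rewrite ?normr1 ?normr0.
Qed.

End Directional.

Section FiniteExceptions.
Context {R : realType}.
Notation mu := (@lebesgue_measure R).
Variables (a b : R) (F : seq R).

Let mF : measurable ([set` F] : set (measurableTypeR R)).
Proof.
apply: countable_measurable; first exact: measurable_set1.
by apply: finite_set_countable; exact: finite_seq.
Qed.

Let muF : mu [set` F] = 0%E.
Proof.
by apply: countable_lebesgue_measure0; apply: finite_set_countable; exact: finite_seq.
Qed.

Lemma le_Rintegral_off (f g : R -> R) :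
  mu.-integrable `[a, b] (EFin \o f) -> mu.-integrable `[a, b] (EFin \o g) ->
  (forall s, a <= s <= b -> s \notin F -> f s <= g s) ->
  \int[mu]_(s in `[a, b]) f s <= \int[mu]_(s in `[a, b]) g s.
Proof.
move=> itf itg fg.
have off h : mu.-integrable `[a, b] (EFin \o h) ->
    \int[mu]_(s in `[a, b]) h s = \int[mu]_(s in `[a, b] `\` [set` F]) h s.
  by move=> ih; rewrite /Rintegral (negligible_integral mF _ ih).
have mD : measurable (`[a, b]%classic `\` [set` F] : set (measurableTypeR R)).
  exact: measurableD.
have itoff h : mu.-integrable `[a, b] (EFin \o h) ->
    mu.-integrable (`[a, b] `\` [set` F]) (EFin \o h).
  by move=> ih; apply: integrableS ih => //; exact: subDsetl.
rewrite !off//; apply: le_Rintegral => //; [exact: itoff|exact: itoff|].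
by move=> s [] /=; rewrite in_itv/= => sab /negP; exact: fg.
Qed.

Lemma integrable_off (f g : R -> R) : measurable_fun `[a, b] f ->
  mu.-integrable `[a, b] (EFin \o g) ->
  (forall s, a <= s <= b -> s \notin F -> `|f s| <= g s) ->
  mu.-integrable `[a, b] (EFin \o f).
Proof.
move=> mf itg fg.
rewrite (negligible_integrable mF)//; last by apply/measurable_EFinP.
have mD : measurable (`[a, b]%classic `\` [set` F] : set (measurableTypeR R)).
  exact: measurableD.
have itg' : mu.-integrable (`[a, b] `\` [set` F]) (EFin \o g).
  by apply: integrableS itg => //; exact: subDsetl.
apply: le_integrable itg' => //.
  by apply/measurable_EFinP; apply: measurable_funS mf => //; exact: subDsetl.
move=> s [] /=; rewrite in_itv/= => sab /negP sF.
by rewrite lee_fin (le_trans (fg s sab sF))// ler_norm.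
Qed.

End FiniteExceptions.

Section Perturbation.
Context {R : realType} {n : nat}.
Notation mu := (@lebesgue_measure R).
Variable L : R -> 'rV[R]_n -> 'rV[R]_n -> R.
Variable U : set (R * 'rV[R]_n * 'rV[R]_n).
Implicit Types (t s r p q M : R) (y d u v : 'rV[R]_n).

(** The path moves the last argument first and the state afterwards. Hence L_y is evaluated at the
    unvaried state y, with only d displaced, while the state step costs at most M |p|. The
    intermediate o is kept because L_y there is compared with its one-sided limits later. *)
Lemma lagrangian_increment_le s y d r M p q (i : 'I_n) :
  (forall u v, `|u| <= r -> `|v| <= r ->
    [/\ has_gradient (fun x' => L s x' (d + v)) (y + u),
        has_gradient (fun y' => L s (y + u) y') (d + v)
      & `|grad_x L s (y + u) (d + v)| <= M]) ->
  `|p| <= r -> `|q| <= r ->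
  exists2 o, `|o| <= `|q| &
    L s (y + p *: delta_mx 0 i) (d + q *: delta_mx 0 i) - L s y d <=
      M * `|p| + q * grad_y L s y (d + o *: delta_mx 0 i) 0 i.
Proof.
move=> H pr qr; have r0 : 0 <= r by exact: le_trans pr.
pose ei : 'rV[R]_n := delta_mx 0 i.
have le_ei o : `|o| <= r -> `|o *: ei| <= r.
  by move=> ?; apply: le_trans (norm_delta_le i o) _.
have [|o op oE] := @MVT_line _ _ (fun x' => L s x' (d + q *: ei)) y ei p.
  by move=> o op; have [|//|+ _ _] := H (o *: ei) (q *: ei) _ _;
    [apply: le_ei; exact: le_trans pr|exact: le_ei|exact].
have [|o' oq o'E] := @MVT_line _ _ (fun y' => L s y y') d ei q.
  move=> o' oq; have [||_ + _] := H 0 (o' *: ei); first by rewrite normr0.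
    by apply: le_ei; exact: le_trans qr.
  by rewrite addr0; exact.
exists o' => //; rewrite -(subrK (L s y (d + q *: ei)) (L _ _ _)) -addrA oE o'E.
have -> : grad_y L s y (d + o' *: ei) 0 i = 'D_ei (fun y' => L s y y') (d + o' *: ei).
  by rewrite mxE.
rewrite lerD2r; apply: le_trans (ler_norm _) _.
rewrite normrM mulrC ler_wpM2r//.
have [||_ _] := H (o *: ei) (q *: ei); [by apply: le_ei; exact: le_trans pr|exact: le_ei|].
apply: le_trans; apply: le_trans (rV_coord_le _ i).
by rewrite mxE.
Qed.

Lemma near_perturbation (f : R * 'rV[R]_n * 'rV[R]_n -> R) (G : set_system R)
    (FG : Filter G) (x D : R -> 'rV[R]_n) t y d (e : R) : 0 < e ->
  {for (t, y, d), continuous f} ->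
  id @ G --> t -> x @ G --> y -> D @ G --> d ->
  \forall s \near G & r \near 0^'+,
    forall v, `|v| <= r -> `|f (s, x s, D s + v) - f (t, y, d)| <= e.
Proof.
move=> e0 fc Gt Gy Gd.
move/cvgrPdist_lt/(_ e e0) : fc => /nbhs_ballP[c /= c0 cH].
have c2 : 0 < c / 2 by rewrite divr_gt0.
exists ([set s | [/\ `|t - s| < c, `|y - x s| < c & `|d - D s| < c / 2]],
        [set r | 0 < r < c / 2]); last first.
  move=> [s r] /= [[ts ys ds] /andP[r0 rc] v vr].
  rewrite distrC ltW//; apply: (cH (s, x s, D s + v)).
  split; [split|]; rewrite -ball_normE//=.
  rewrite opprD addrA; apply: le_lt_trans (ler_normB _ _) _.
  by rewrite (splitr c) ltrD// (le_lt_trans vr).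
split=> /=.
  move/cvgrPdist_lt : Gt => /(_ c c0) Gt.
  move/cvgrPdist_lt : Gy => /(_ c c0) Gy.
  move/cvgrPdist_lt : Gd => /(_ _ c2) Gd.
  by near=> s; split; near: s.
near=> r; apply/andP; split; near: r; first exact: nbhs_right_gt.
exact: nbhs_right_lt.
Unshelve. all: by end_near. Qed.

Hypothesis UL : forall t y d, U (t, y, d) ->
  {for (t, y, d), continuous (fun z => L z.1.1 z.1.2 z.2)}.

Lemma integrable_lagrangian t0 t1 b M (F : seq R) (y D : R -> 'rV[R]_n) : t0 <= t1 -> 0 < b ->
  (forall s, t0 < s < t1 -> s \notin F ->
    {for s, continuous y} /\ {for s, continuous D}) ->
  (forall s, t0 <= s <= t1 -> s \notin F ->
    U (s, y s, D s) /\ `|L s (y s) (D s)| <= M) ->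
  mu.-integrable `[t0, t1]
    (EFin \o (fun s => (t1 - s) `^ (b - 1) * L s (y s) (D s))).
Proof.
move=> t01 b0 yD UM.
have iw := integrableZl _ M (integrable_kernel b0 t01).
apply: (@integrable_off _ _ _ F _ (fun s => M * (t1 - s) `^ (b - 1))).
- apply: measurable_funM; first exact: measurable_kernel.
  apply: (@measurable_fun_piecewise_continuous _ _ _ F) => s tin sF.
  have [yc Dc] := yD s tin sF.
  have [|Us _] := UM s _ sF; first by case/andP: tin => /ltW -> /ltW ->.
  have sc : (q, y q, D q) @[q --> s] --> (s, y s, D s).
    exact: (cvg_pair (cvg_pair cvg_id yc) Dc).
  exact: (cvg_comp _ _ sc (UL Us)).
- by apply: eq_integrable (iw _).
- move=> s sin sF; rewrite normrM (ger0_norm (powR_ge0 _ _)) mulrC ler_wpM2r ?powR_ge0//.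
  by have [] := UM s sin sF.
Qed.

End Perturbation.

(** * Densities, fractional integrals and norms of needles *)

Section NeedleVariation.
Context {R : realType} {n : nat}.
Notation mu := (@lebesgue_measure R).
Implicit Types (t s e k al tau : R) (v : 'rV[R]_n).

Lemma needle_density_far tau k e s : 0 < e -> s < tau - e \/ tau + e <= s ->
  needle_density tau k e s = 0.
Proof.
move=> e0 [se|es]; rewrite /needle_density /step.
  have s1 : s < tau by lra.
  have s2 : s < tau + e by lra.
  by rewrite (lt_geF se) (lt_geF s1) (lt_geF s2) /=; ring.
have s1 : tau - e <= s by lra.
have s2 : tau <= s by lra.
by rewrite es s1 s2 /=; ring.
Qed.

Lemma needle_density_left tau k e s : 0 < e -> tau - e <= s < tau ->
  needle_density tau k e s = 1.
Proof.
move=> e0 /andP[es st]; have s1 : s < tau + e by lra.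
by rewrite /needle_density /step es (lt_geF st) (lt_geF s1) /=; ring.
Qed.

Lemma needle_density_right tau k e s : 0 < e -> tau <= s < tau + e ->
  needle_density tau k e s = - k.
Proof.
move=> e0 /andP[ts se]; have s1 : tau - e <= s by lra.
by rewrite /needle_density /step ts (lt_geF se) s1 /=; ring.
Qed.

Lemma needle_density_le tau k e s : 0 < e -> 0 <= k <= 2 ->
  `|needle_density tau k e s| <= 2.
Proof.
move=> e0 k2; have [se|es] := ltP s (tau - e).
  by rewrite needle_density_far ?normr0//; left.
have [st|ts] := ltP s tau; first by rewrite needle_density_left ?normr1 ?es//; lra.
have [se|es'] := ltP s (tau + e).
  by rewrite needle_density_right ?ts// normrN ger0_norm; lra.
by rewrite needle_density_far ?normr0//; right.
Qed.

Lemma piecewise_continuous_needle t0 t1 tau k e v :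
  piecewise_continuous t0 t1 [:: tau - e; tau; tau + e]
    (fun s => needle_density tau k e s *: v).
Proof.
have p a := piecewise_continuous_step t0 t1 a v.
have := piecewise_continuousD k
  (piecewise_continuousD (- (1 + k)) (p (tau - e)) (p tau)) (p (tau + e)).
apply: piecewise_continuous_eq => s _ _.
by rewrite !scalerA -!scalerDl /needle_density mulNr.
Qed.

Lemma frac_int_needle t0 al tau k e v t : 0 < al -> 0 < e -> t0 <= tau - e -> t0 <= t ->
  frac_int t0 al (fun s => needle_density tau k e s *: v) t =
  ((Gamma al)^-1 * needle al tau k e t) *: v.
Proof.
move=> al0 e0 t0e t0t; apply/rowP => j; rewrite !mxE -mulrA; congr (_ * _).
have [id <-] := Rintegral_needle k al0 e0 t0e t0t.
rewrite -(RintegralZr (v 0 j) _ id)//; apply: eq_Rintegral => s _.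
by rewrite !mxE mulrA.
Qed.

Lemma PCalpha_norm_le t0 t1 al (F : seq R) (phi : R -> 'rV[R]_n) A B :
  t0 <= t1 -> 0 <= B ->
  (forall t, t0 <= t <= t1 -> `|phi t| <= A) ->
  (forall t, t0 <= t <= t1 -> t \notin F -> `|caputo t0 t1 al phi t| <= B) ->
  (PCalpha_norm t0 t1 al phi <= (A + B)%:E)%E.
Proof.
move=> t01 B0 phiA DB; rewrite EFinD; apply: leeD.
  apply: ge_ereal_sup => _ /= [t + <-]; rewrite in_itv/= => tin.
  by rewrite lee_fin; exact: phiA.
(* The norm at infinity is 0 by convention when the total measure is 0; this case uses 0 <= B. *)
rewrite /Linfty_norm unlock /=; case: ifPn => _; last by rewrite lee_fin.
apply/ess_sup_inf.ess_supP.
have mF : measurable ([set` F] : set (measurableTypeR R)).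
  apply: countable_measurable; first exact: measurable_set1.
  by apply: finite_set_countable; exact: finite_seq.
have mI : measurable (`[t0, t1]%classic : set (measurableTypeR R)) by [].
(* The restricted measure ignores the complement of the segment, so only the finite set F counts. *)
exists ([set` F] `|` ~` `[t0, t1]); split.
- by apply: measurableU => //; exact: measurableC.
- have E : ([set` F] `|` ~` `[t0, t1]) `&` `[t0, t1]%classic = [set` F] `&` `[t0, t1].
    by rewrite setIUl setICl setU0.
  have muF : mu [set` F] = 0%E.
    by apply: countable_lebesgue_measure0; apply: finite_set_countable; exact: finite_seq.
  transitivity (mu ([set` F] `&` `[t0, t1]%classic)); first by rewrite -E.
  apply: (subset_measure0 _ _ _ muF) => //.
  exact: measurableI.
- move=> t /= tB; apply: contrapT => /not_orP[/negP tF /contrapT tin].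
  apply: tB; rewrite lee_fin normr_id; exact: DB.
Qed.

End NeedleVariation.

Lemma Rintegral_linear {R : realType} (a b p q : R) (f g : R -> R) :
  let mu := @lebesgue_measure R in
  mu.-integrable `[a, b] (EFin \o f) -> mu.-integrable `[a, b] (EFin \o g) ->
  mu.-integrable `[a, b] (EFin \o (fun s => p * f s + q * g s)) /\
  \int[mu]_(s in `[a, b]) (p * f s + q * g s) =
  p * \int[mu]_(s in `[a, b]) f s + q * \int[mu]_(s in `[a, b]) g s.
Proof.
move=> mu itf itg.
have itZ r (h : R -> R) : mu.-integrable `[a, b] (EFin \o h) ->
    mu.-integrable `[a, b] (EFin \o (fun s => r * h s)).
  by move=> ih; apply: eq_integrable (integrableZl _ r ih).
have itfp := itZ p _ itf; have itgq := itZ q _ itg.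
split; first by apply: eq_integrable (integrableD _ itfp itgq).
by rewrite (RintegralD _ itfp itgq)// (RintegralZl p _ itf)// (RintegralZl q _ itg).
Qed.

(** Meant for the integrands f1 along x and f2 along the variation, with I = w |h| / d up to a
    constant. Integration gives lam * d times the conclusion, as each half of the needle has width
    d. The number y depends on s because it comes from the mean value theorem. *)
Lemma needle_integral_ge0 {R : realType} (t0 t1 tau k d lam K A B : R) (F : seq R)
    (f1 f2 I : R -> R) :
  let mu := @lebesgue_measure R in
  0 < d -> t0 <= tau - d -> tau + d <= t1 -> 0 <= k -> 0 < lam ->
  mu.-integrable `[t0, t1] (EFin \o f1) -> mu.-integrable `[t0, t1] (EFin \o f2) ->
  mu.-integrable `[t0, t1] (EFin \o I) ->
  \int[mu]_(s in `[t0, t1]) f1 s <= \int[mu]_(s in `[t0, t1]) f2 s ->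
  (forall s, t0 <= s <= t1 -> s \notin F -> exists y,
     [/\ f2 s - f1 s <= lam * (K * d) * I s + lam * needle_density tau k d s * y,
        tau - d <= s < tau -> y <= A & tau <= s < tau + d -> - y <= B]) ->
  0 <= K * \int[mu]_(s in `[t0, t1]) I s + (A + k * B).
Proof.
move=> mu d0 t0d dt1 k0 lam0.
have tau0 : t0 <= tau - d <= t1 by lra.
have tau1 : t0 <= tau <= t1 by lra.
have tau2 : t0 <= tau + d <= t1 by lra.
(* Differences of steps are the indicators of the two halves of the needle, each with integral d. *)
have dens_le s y : (tau - d <= s < tau -> y <= A) -> (tau <= s < tau + d -> - y <= B) ->
    needle_density tau k d s * y <=
    A * (1 * step (tau - d) s + -1 * step tau s) +
    k * B * (1 * step tau s + -1 * step (tau + d) s).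
  move=> yA yB; rewrite /step; have [sd|ds] := ltP s (tau - d).
    rewrite needle_density_far//; last by left.
    have s1 : s < tau by lra.
    have s2 : s < tau + d by lra.
    by rewrite (lt_geF s1) (lt_geF s2) /= !(mulr0, mul0r, addr0).
  have [st|ts] := ltP s tau.
    have s2 : s < tau + d by lra.
    rewrite needle_density_left// ?ds// (lt_geF s2) /= !(mulr0, mulr1, addr0, mul1r).
    by apply: yA; rewrite ds.
  have [sd|ds'] := ltP s (tau + d).
    rewrite needle_density_right// ?ts//= !(mulr1, mulr0, addr0, subrr, add0r).
    by rewrite mulNr -mulrN ler_wpM2l// yB// ts.
  rewrite needle_density_far//=; last by right.
  by rewrite !(mulr1, mulr0, mul0r, addr0, subrr, add0r).
move=> if1 if2 iI f12 H.
have [[is0 Is0] [is1 Is1] [is2 Is2]] :=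
  And3 (Rintegral_step tau0) (Rintegral_step tau1) (Rintegral_step tau2).
have [iB1 IB1] := Rintegral_linear 1 (-1) is0 is1.
have [iB2 IB2] := Rintegral_linear 1 (-1) is1 is2.
have [iB IB] := Rintegral_linear A (k * B) iB1 iB2.
have [ig Ig] := Rintegral_linear (lam * (K * d)) lam iI iB.
have [id Id] := Rintegral_linear 1 (-1) if2 if1.
have /(_ F) le12 := @le_Rintegral_off _ _ _ _ _ _ id ig.
have : 0 <= lam * d * (K * \int[mu]_(s in `[t0, t1]) I s + (A + k * B)).
  have -> : lam * d * (K * \int[mu]_(s in `[t0, t1]) I s + (A + k * B)) =
      \int[mu]_(s in `[t0, t1]) (lam * (K * d) * I s + lam *
        (A * (1 * step (tau - d) s + -1 * step tau s) +
         k * B * (1 * step tau s + -1 * step (tau + d) s))).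
    by rewrite Ig IB IB1 IB2 Is0 Is1 Is2; ring.
  apply: le_trans (le12 _) => [|s sin sF].
    by rewrite Id mul1r mulN1r subr_ge0.
  have [y [yle yA yB]] := H s sin sF.
  rewrite mul1r mulN1r; apply: le_trans yle _.
  by rewrite lerD2l -mulrA ler_pM2l// dens_le.
by rewrite pmulr_rge0// mulr_gt0.
Qed.

(** * The inequality between the one-sided values of L_y, for either sign of the needle *)

Section NeedleInequality.
Context {R : realType} {n : nat}.
Notation mu := (@lebesgue_measure R).
Variables (t0 t1 al b : R) (xa xb : 'rV[R]_n).
Variables (L : R -> 'rV[R]_n -> 'rV[R]_n -> R) (x : R -> 'rV[R]_n).
Hypotheses (t01 : t0 < t1) (al01 : 0 < al <= 1) (b0 : 0 < b).
Hypothesis xmin : weak_local_min t0 t1 al b xa xb L x.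
Hypothesis L1 : C1xy_near L (graph_caputo t0 t1 al x).
Notation D := (caputo t0 t1 al x).
Notation c := (caputo_cst al).
Notation w t := ((t1 - t) `^ (b - 1)).
Variables (tau : R) (i : 'I_n) (sg : R).
Hypotheses (tin : t0 < tau < t1) (c0 : c != 0) (sg1 : `|sg| = 1).
Let pl := w tau * (sg * grad_y L tau (x tau) (lim (D @ tau^'-)) 0 i).
Let pr := w tau * (sg * grad_y L tau (x tau) (lim (D @ tau^'+)) 0 i).
Let ei : 'rV[R]_n := delta_mx 0 i.
Implicit Types (s t e k r p q : R).

(** Uniform in v because the mean value theorem returns L_y at an unknown displacement. The weight
    is continuous at tau since tau < t1. *)
Let near_sides (e : R) : 0 < e -> exists2 r, 0 < r &
  forall s v, `|v| <= r ->
    (tau - r < s < tau ->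
      `|w s * (sg * grad_y L s (x s) (D s + v) 0 i) - pl| <= e) /\
    (tau < s < tau + r ->
      `|w s * (sg * grad_y L s (x s) (D s + v) 0 i) - pr| <= e).
Proof.
move=> e0; have [[xPC _ _] _] := xmin; have [xc _] := xPC.
have [F0 F0in DF] := PCalpha_caputo t01 al01 xPC.
have [U [oU gU UL]] := L1; have /andP[t0tau taut1] := tin.
have tau1 : t0 < tau <= t1 by rewrite t0tau ltW.
have tau2 : t0 <= tau < t1 by rewrite taut1 ltW.
have tau3 : t0 <= tau <= t1 by rewrite !ltW.
pose f (z : R * 'rV[R]_n * 'rV[R]_n) :=
  w z.1.1 * (sg * grad_y L z.1.1 z.1.2 z.2 0 i).
have fc d : U (tau, x tau, d) -> {for (tau, x tau, d), continuous f}.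
  move=> /UL[_ _ _ _ gc]; apply: cvgM.
    apply: (@cvg_comp _ _ _ (fun z : R * 'rV[R]_n * 'rV[R]_n => z.1.1) (fun s => w s)
      _ (nbhs tau)).
      exact: (cvg_comp _ _ cvg_fst cvg_fst).
    exact: continuous_kernel.
  by apply: cvgM; [exact: cvg_cst|exact: cvg_coord].
have [Dl Dr _] := DF.
have [[A B] [/= [a /= a0 aA] B0] AB] := near_perturbation _ e0
  (fc _ (gU _ (graph_left F0in DF tau1)))
  (cvg_at_left_filter cvg_id) (continuous_at_in_left tau1 (xc _ tau3)) (Dl _ tau1).
have [[A' B'] [/= [a' /= a'0 aA'] B'0] AB'] := near_perturbation _ e0
  (fc _ (gU _ (graph_right F0in DF tau2)))
  (cvg_at_right_filter cvg_id) (continuous_at_in_right tau2 (xc _ tau3)) (Dr _ tau2).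
near (0 : R)^'+ => r.
have r0 : 0 < r by near: r; exact: nbhs_right_gt.
have ra : r < a by near: r; exact: nbhs_right_lt.
have ra' : r < a' by near: r; exact: nbhs_right_lt.
have rA s : tau - r < s < tau -> A s.
  by move=> sin; apply: aA => /=; [rewrite gtr0_norm|]; lra.
have rA' s : tau < s < tau + r -> A' s.
  by move=> sin; apply: aA' => /=; [rewrite ltr0_norm|]; lra.
exists r => // s v vr; split=> sin.
  apply: (AB (s, r)) => //; split; first exact: rA.
  exact: (near B0 r).
apply: (AB' (s, r)) => //; split; first exact: rA'.
exact: (near B'0 r).
Unshelve. all: by end_near. Qed.

(** K precedes e and d: it multiplies an integral that tends to 0 only with d, so it must stay fixed
    in that limit. *)
Let needle_bound : exists K, forall e, 0 < e -> exists2 r, 0 < r &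
  forall d k, 0 < d < r -> 0 <= k <= 2 -> needle al tau k d t1 = 0 ->
  mu.-integrable `[t0, t1] (EFin \o (fun t => w t * `|needle al tau k d t / d|)) ->
  0 <= K * \int[mu]_(t in `[t0, t1]) (w t * `|needle al tau k d t / d|) +
    ((pl + e) + k * (- pr + e)).
Proof.
have [[xPC xxa xxb] [dl dl0 Hmin]] := xmin.
have [xc _] := xPC.
have [F0 F0in DF] := PCalpha_caputo t01 al01 xPC.
have [U [oU gU UL]] := L1.
have UL1 t y d : U (t, y, d) ->
    {for (t, y, d), continuous (fun z => L z.1.1 z.1.2 z.2)}.
  by move=> /UL[].
have UL2 t y d : U (t, y, d) ->
    {for (t, y, d), continuous (fun z => L z.1.1 z.1.2 z.2)} /\
    {for (t, y, d), continuous (fun z => grad_x L z.1.1 z.1.2 z.2)}.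
  by move=> /UL[].
have [r r0 rH] := graph_neighborhood F0in DF xc oU gU UL2.
(* The density carries c^-1 so that the Caputo derivative of the variation is exactly sg times the
   needle density; [kap] is the factor this leaves in h. *)
pose kap := (Gamma al)^-1 * (c^-1 * sg).
have al0 : 0 < al by case/andP: al01.
have /andP[t0tau taut1] := tin.
exists (r^-1 * `|kap|) => e e0.
have [rho rho0 rhoH] := near_sides e0.
pose m := Num.min rho (Num.min (tau - t0) (t1 - tau)).
exists m; first by rewrite !lt_min rho0 !subr_gt0 t0tau taut1.
move=> d k; rewrite !lt_min => /andP[d0 /and3P[drho dt0 dt1]] k2 nd1 ind.
pose v : 'rV[R]_n := (c^-1 * sg) *: ei.
pose chi s := needle_density tau k d s *: v.
pose nd := needle al tau k d.
pose h t : 'rV[R]_n := (kap * nd t) *: ei.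
pose G := [:: tau - d; tau; tau + d].
have Gin s : s \in G -> t0 < s < t1.
  by rewrite !inE => /or3P[] /eqP ->; lra.
have hE t : t0 <= t <= t1 -> h t = frac_int t0 al chi t.
  move=> /andP[t0t _]; rewrite frac_int_needle//; last by lra.
  by rewrite /v scalerA /h /kap; congr (_ *: _); rewrite mulrAC.
have hc t : t0 <= t <= t1 -> continuous_at_in t0 t1 h t.
  move=> _; have : {for t, continuous h}.
    apply: cvgZl; apply: cvgM; first exact: cvg_cst.
    exact: needle_continuous.
  by move=> hct; apply: cvg_trans hct; apply: cvg_app; exact: cvg_within.
have [F1 [GF1 F1in _ F1H]] := PCalpha_variation t01 al01 xPC Gin
  (piecewise_continuous_needle t0 t1 tau k d v) hc hE.
have [N N0 ndN] : exists2 N, 0 < N & forall t, t0 <= t <= t1 -> `|nd t| <= N.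
  apply: (@piecewise_continuous_bounded _ R^o _ _ [::]); split=> t _.
  - apply/cvg_ex; exists (nd t); apply: cvg_at_left_filter; exact: needle_continuous.
  - apply/cvg_ex; exists (nd t); apply: cvg_at_right_filter; exact: needle_continuous.
  - move=> _; apply: cvg_trans (cvg_app _ (cvg_within _)) _; exact: needle_continuous.
(* Q bounds the norm of h plus that of its Caputo derivative (N for the needle, 2 for its density).
   Taking lam Q = La / 2 keeps the variation inside the tube, the [near_sides] radius and the weak
   neighborhood at once. *)
pose Q := `|kap| * N + 2.
have Q2 : 2 <= Q by rewrite lerDr mulr_ge0// ltW.
have Q0 : 0 < Q by lra.
pose La := Num.min r (Num.min rho dl).
have La0 : 0 < La by rewrite !lt_min r0 rho0.
have [lam lam0 lamQ] : exists2 lam, 0 < lam & lam * Q = La / 2.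
  exists (La / (2 * Q)); first by rewrite divr_gt0// mulr_gt0.
  by field; rewrite gt_eqF.
have La2 : La / 2 < La by rewrite ltr_pdivrMr// ltr_pMr// ltr1n.
have [Lar [Larho Ladl]] : La <= r /\ La <= rho /\ La <= dl.
  by rewrite !ge_min !lexx !orbT.
have [zPC zE zxE] := F1H lam.
set z := (fun t => x t + lam *: h t) in zPC zE zxE.
have capz t : lam *: (c *: chi t) = (lam * sg * needle_density tau k d t) *: ei.
  rewrite /chi /v !scalerA; congr (_ *: _); field => //.
have lamN t : t0 <= t <= t1 -> `|lam * kap * nd t| <= lam * (`|kap| * N).
  move=> tin'; rewrite (normrM (lam * kap)) (normrM lam) (gtr0_norm lam0) -mulrA
    ler_wpM2l ?(ltW lam0)//.
  by rewrite ler_wpM2l// ndN.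
have lam2 t : `|lam * sg * needle_density tau k d t| <= lam * 2.
  rewrite (normrM (lam * sg)) (normrM lam) sg1 mulr1 (gtr0_norm lam0) ler_wpM2l ?(ltW lam0)//.
  exact: needle_density_le.
have lamNr : lam * (`|kap| * N) <= r.
  have : lam * (`|kap| * N) <= lam * Q by rewrite ler_wpM2l ?(ltW lam0)// lerDl.
  by lra.
have lam2r : lam * 2 <= La / 2 by rewrite -lamQ ler_wpM2l ?(ltW lam0).
have zadm : admissible t0 t1 al xa xb z.
  split=> //; rewrite /z /h /nd ?nd1 ?mulr0 ?scale0r ?scaler0 ?addr0//.
  by rewrite needle_left ?mulr0 ?scale0r ?scaler0 ?addr0//; lra.
have Jle : functional t0 t1 al b L x <= functional t0 t1 al b L z.
  apply: Hmin => //; apply: (@le_lt_trans _ _ (lam * (`|kap| * N) + lam * 2)%:E).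
    apply: (@PCalpha_norm_le _ _ _ _ _ F1) => //.
    - exact: ltW.
    - by rewrite mulr_ge0// ltW.
    - move=> t tin'; have -> : (z \- x)%R t = (lam * kap * nd t) *: ei.
        by rewrite /z /= addrAC subrr add0r /h scalerA mulrA.
      by apply: le_trans (norm_delta_le i _) _; exact: lamN.
    - move=> t tin' tF; rewrite zxE// capz.
      by apply: le_trans (norm_delta_le i _) _; exact: lam2.
  by rewrite lte_fin -mulrDr -/Q lamQ; lra.
(* F2 is where the derivative of z itself may fail to be continuous; it enters through the
   measurability of the integrand along z. *)
have [F2 F2in DzF] := PCalpha_caputo t01 al01 zPC.
pose F := F0 ++ F1 ++ F2.
have subF s : s \notin F -> [/\ s \notin F0, s \notin F1 & s \notin F2].
  by rewrite !mem_cat !negb_or => /and3P[].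
have itv_in s : t0 < s < t1 -> t0 <= s <= t1 by case/andP => /ltW -> /ltW ->.
have pr' s : t0 <= s <= t1 -> `|lam * kap * nd s| <= r.
  by move=> sin; apply: le_trans (lamN s sin) lamNr.
have qr' s : `|lam * sg * needle_density tau k d s| <= r.
  by apply: le_trans (lam2 s) _; rewrite (le_trans lam2r)// (le_trans (ltW La2)).
have zs s : z s = x s + (lam * kap * nd s) *: ei by rewrite /z /h scalerA mulrA.
have Dzs s : t0 <= s <= t1 -> s \notin F1 -> caputo t0 t1 al z s =
    D s + (lam * sg * needle_density tau k d s) *: ei.
  by move=> sin sF1; rewrite zE// capz.
have ix : mu.-integrable `[t0, t1] (EFin \o (fun s => w s * L s (x s) (D s))).
  apply: (@integrable_lagrangian _ _ _ U UL1 _ _ _ r^-1 F) => //; first exact: ltW.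
    move=> s sin /subF[sF0 _ _]; split.
      by apply/(continuous_at_in_interior _ sin); exact: xc (itv_in _ sin).
    by apply/(continuous_at_in_interior _ sin); case: DF => _ _; apply; rewrite ?itv_in.
  move=> s sin /subF[sF0 _ _].
  have [||+ + _] := rH s sin sF0 0 0; rewrite ?normr0 ?(ltW r0)//.
  by rewrite !addr0.
have iz : mu.-integrable `[t0, t1]
    (EFin \o (fun s => w s * L s (z s) (caputo t0 t1 al z s))).
  apply: (@integrable_lagrangian _ _ _ U UL1 _ _ _ r^-1 F) => //; first exact: ltW.
    move=> s sin /subF[_ _ sF2]; split.
      by apply/(continuous_at_in_interior _ sin); case: zPC => + _; apply; exact: itv_in.
    by apply/(continuous_at_in_interior _ sin); case: DzF => _ _; apply; rewrite ?itv_in.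
  move=> s sin /subF[sF0 sF1 _]; rewrite zs Dzs//.
  have [||+ + _] := rH s sin sF0 ((lam * kap * nd s) *: ei)
    ((lam * sg * needle_density tau k d s) *: ei) => //.
    by apply: le_trans (norm_delta_le i _) _; exact: pr'.
  by apply: le_trans (norm_delta_le i _) _; exact: qr'.
apply: (@needle_integral_ge0 _ t0 t1 tau k d lam (r^-1 * `|kap|) _ _ F _ _ _
  d0 _ _ _ lam0 ix iz ind Jle) => //.
- by rewrite lerBrDr addrC -lerBrDr ltW.
- by rewrite addrC -lerBrDr ltW.
- by case/andP: k2.
move=> s sin /subF[sF0 sF1 _]; rewrite zs Dzs//.
have [|||o oq inc] := @lagrangian_increment_le _ _ L s (x s) (D s) r r^-1
    (lam * kap * nd s) (lam * sg * needle_density tau k d s) i.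
- move=> u' v' ur vr; have [Us _ gs] := rH s sin sF0 u' v' ur vr.
  by have [] := UL _ _ _ Us.
- exact: pr'.
- exact: qr'.
exists (w s * (sg * grad_y L s (x s) (D s + o *: ei) 0 i)).
have orho : `|o *: ei| <= rho.
  apply: le_trans (norm_delta_le i o) _; apply: le_trans oq _.
  by apply: le_trans (lam2 s) _; rewrite (le_trans lam2r)// (le_trans (ltW La2)).
have [sL sR] := rhoH s _ orho.
split.
- rewrite -mulrBr; apply: le_trans (ler_wpM2l (powR_ge0 _ _) inc) _.
  rewrite le_eqVlt; apply/orP; left; apply/eqP.
  rewrite (normrM (lam * kap)) (normrM lam) (gtr0_norm lam0) (normrM (nd s)).
  by rewrite normfV (gtr0_norm d0); field; rewrite ?gt_eqF.
- move=> /andP[ds st].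
  have /sL : tau - rho < s < tau.
    by rewrite st andbT (lt_le_trans _ ds)// ltrD2l ltrN2.
  by rewrite ler_distl => /andP[_].
- move=> /andP[ts sd].
  have /sR : tau < s < tau + rho.
    rewrite (lt_trans sd) ?ltrD2l// andbT lt_neqAle ts andbT.
    (* [near_sides] says nothing at tau, but tau is a jump of the needle density and so lies in the
       excluded set F1. *)
    by apply: contraNneq sF1 => <-; apply: GF1; rewrite !inE eqxx orbT.
  by rewrite ler_distl => /andP[prle _]; rewrite lerNl opprD opprK.
Qed.

Lemma needle_inequality : 0 <= pl - pr.
Proof.
have [K KH] := needle_bound; have /andP[t0tau taut1] := tin.
apply/ler_addgt0Pr => e e0.
(* The tolerance enters once for each half of the needle, with total weight 1 + k tending to 2. *)
have [r r0 rH] := KH (e / 2) ltac:(by rewrite divr_gt0).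
have T0 : 0 < t1 - tau by rewrite subr_gt0.
have al0 : 0 < al by case/andP: al01.
have m0 : 0 < Num.min r (t1 - tau) by rewrite lt_min r0.
have [d [dm k2 kcv ind Icv]] := needle_small tin al01 b0 m0.
have ge0 m : 0 <= K * \int[mu]_(t in `[t0, t1])
      (w t * `|needle al tau (needle_coef al (t1 - tau) (d m)) (d m) t / d m|) +
    ((pl + e / 2) + needle_coef al (t1 - tau) (d m) * (- pr + e / 2)).
  have /andP[d0] := dm m; rewrite lt_min => /andP[dr dT].
  apply: rH => //; first by rewrite d0.
  by rewrite needleE needle_coefP// d0.
set I := (fun m => \int[mu]_(t in `[t0, t1]) _) in Icv.
set k := (fun m => needle_coef al (t1 - tau) (d m)) in kcv.
have ucv : K * I m + ((pl + e / 2) + k m * (- pr + e / 2)) @[m --> \oo] -->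
    K * 0 + ((pl + e / 2) + 1 * (- pr + e / 2)).
  apply: cvgD; first by apply: cvgM => //; exact: cvg_cst.
  by apply: cvgD; [exact: cvg_cst|apply: cvgM => //; exact: cvg_cst].
have -> : pl - pr + e = K * 0 + ((pl + e / 2) + 1 * (- pr + e / 2)) by field.
rewrite -(cvg_lim _ ucv)//; apply: limr_ge; last by apply: nearW => m; exact: ge0.
by apply/cvg_ex; eexists; exact: ucv.
Qed.

End NeedleInequality.

(** * Passage from minima to maxima, and the conclusion at a corner *)

Section Maximum.
Context {R : realType} {n : nat}.
Notation mu := (@lebesgue_measure R).
Implicit Types (t : R) (x : R -> 'rV[R]_n) (L : R -> 'rV[R]_n -> 'rV[R]_n -> R).

(** [functional] is total, so the sign must pass also through integrals that are infinite or
    undefined; [fine] sends these to 0 on both sides. *)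
Lemma RintegralN (A : set R) (f : R -> R) :
  \int[mu]_(s in A) (- f s) = - \int[mu]_(s in A) f s.
Proof.
have -> : \int[mu]_(s in A) (- f s) = fine (\int[mu]_(s in A) (\- (EFin \o f))%E s) by [].
have -> : \int[mu]_(s in A) f s = fine (\int[mu]_(s in A) (EFin \o f) s) by [].
move: (EFin \o f) => g.
rewrite (integralE mu A g) (integralE mu A (\- g)%E) funeposN funenegN.
have : (0 <= \int[mu]_(s in A) g^\+ s)%E.
  by apply: integral_ge0 => s _; exact: funepos_ge0.
have : (0 <= \int[mu]_(s in A) g^\- s)%E.
  by apply: integral_ge0 => s _; exact: funeneg_ge0.
case: (integral mu A (g^\-)%E) => [p| |]//;
  case: (integral mu A (g^\+)%E) => [q| |]//= _ _; rewrite ?oppr0//.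
by rewrite opprB.
Qed.

Let oppL L := fun t (y d : 'rV[R]_n) => - L t y d.

Lemma gradientN (f : 'rV[R]_n -> R) y : has_gradient f y ->
  has_gradient (fun z => - f z) y /\ gradient (fun z => - f z) y = - gradient f y.
Proof.
move=> fy; split; first by move=> i; exact: derivableN.
by apply/rowP => i; rewrite !mxE deriveN.
Qed.

(** The gradient of - L is the negated gradient only where the latter exists, that is on U, so the
    equality holds near the point and not globally. *)
Lemma continuous_nearN {T : topologicalType} {V : normedModType R} (f g : T -> V) p :
  (\forall q \near p, g q = - f q) -> {for p, continuous f} -> {for p, continuous g}.
Proof.
move=> gf cf; rewrite /prop_for /continuous_at (nbhs_singleton gf).
have /near_eq_cvg/cvg_trans : {near p, (fun q => - f q) =1 g}.
  by apply: filterS gf => q ->.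
by apply; exact: cvgN.
Qed.

Lemma C1xy_nearN L G : C1xy_near L G -> C1xy_near (oppL L) G.
Proof.
move=> [U [oU GU UL]]; exists U; split; [exact: oU|exact: GU|move=> t y d Utyd].
have [gx gy Lc gxc gyc] := UL _ _ _ Utyd.
have Un : \forall p \near (t, y, d), U p by exact: open_nbhs_nbhs.
split.
- by have [] := gradientN gx.
- by have [] := gradientN gy.
- exact: cvgN.
- apply: continuous_nearN gxc; apply: filterS Un => -[[t' y'] d'] /= /UL[g' _ _ _ _].
  by have [_] := gradientN g'.
- apply: continuous_nearN gyc; apply: filterS Un => -[[t' y'] d'] /= /UL[_ g' _ _ _].
  by have [_] := gradientN g'.
Qed.

Lemma functionalN t0 t1 al b L x :
  functional t0 t1 al b (oppL L) x = - functional t0 t1 al b L x.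
Proof.
rewrite /functional -RintegralN; apply: eq_Rintegral => s _.
by rewrite /oppL mulrN.
Qed.

Lemma weak_local_maxN t0 t1 al b a0 a1 L x : weak_local_max t0 t1 al b a0 a1 L x ->
  weak_local_min t0 t1 al b a0 a1 (oppL L) x.
Proof.
move=> [adm [d d0 H]]; split; [exact: adm|exists d; [exact: d0|move=> z zadm zd]].
by rewrite !functionalN lerN2; exact: H.
Qed.

Lemma caputo_cst0_lim t0 t1 al x t : t0 < t1 -> 0 < al <= 1 ->
  PCalpha t0 t1 al x -> caputo_cst al = 0 -> t0 < t < t1 ->
  lim (caputo t0 t1 al x @ t^'-) = 0 /\ lim (caputo t0 t1 al x @ t^'+) = 0.
Proof.
move=> t01 al01 [_ [psi [/PC_piecewise_continuous[F Fin psiF] xE]]] c0 tin.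
have D0 : \forall s \near t, s != t -> caputo t0 t1 al x s = 0.
  have := near_in tin; have := near_notin_seq F t.
  apply: filterS2 => s sF sin st.
  by rewrite (caputoE t01 al01 psiF xE sin (sF st)) c0 scale0r.
have lim0 (G : set_system R) : ProperFilter G -> (\forall s \near G, 0 = caputo t0 t1 al x s) ->
    lim (caputo t0 t1 al x @ G) = 0.
  move=> PG G0; apply/cvg_lim; first exact: norm_hausdorff.
  have /near_eq_cvg/cvg_trans : {near G, (fun=> 0) =1 caputo t0 t1 al x} by [].
  by apply; exact: cvg_cst.
by split; apply: lim0; move: D0; rewrite near_withinE; apply: filterS => s + st;
  move=> ->//; rewrite ?(lt_eqF st) ?(gt_eqF st).
Qed.

Lemma signed_eq (w p q : R) : 0 < w ->
  (forall sg, `|sg| = 1 -> 0 <= w * (sg * p) - w * (sg * q)) -> p = q.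
Proof.
move=> w0 h; have := h 1 (normr1 _); have := h (-1) (normrN1 _).
rewrite -!mulrBr !(pmulr_rge0 _ w0) mul1r mulN1r opprB !subr_ge0 => le1 le2.
by apply/eqP; rewrite eq_le le1 le2.
Qed.

Lemma erdmann_min t0 t1 al b a0 a1 L x : t0 < t1 -> 0 < al <= 1 -> 0 < b ->
  weak_local_min t0 t1 al b a0 a1 L x ->
  C1xy_near L (graph_caputo t0 t1 al x) ->
  forall t, corner_points t0 t1 al x t ->
    grad_y L t (x t) (lim (caputo t0 t1 al x @ t^'-)) =
    grad_y L t (x t) (lim (caputo t0 t1 al x @ t^'+)).
Proof.
move=> t01 al01 b0 xmin L1 t [tin _].
have [c0|c0] := eqVneq (caputo_cst al) 0.
  have xadm : PCalpha t0 t1 al x by case: xmin => -[].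
  by have [-> ->] := caputo_cst0_lim t01 al01 xadm c0 tin.
apply/rowP => i.
have w0 : 0 < (t1 - t) `^ (b - 1) by rewrite powR_gt0// subr_gt0; case/andP: tin.
by apply: (signed_eq w0) => sg sg1; exact: (needle_inequality t01 al01 b0 xmin L1 i tin c0 sg1).
Qed.

End Maximum.

Theorem corollary1 (R : realType) (n : nat) (t0 t1 alpha beta : R)
    (a b : 'rV[R]_n) (L : R -> 'rV[R]_n -> 'rV[R]_n -> R) (x : R -> 'rV[R]_n)
    (ht : t0 < t1) (halpha : 0 < alpha <= 1) (hbeta : 0 < beta)
    (hx : weak_local_extremum t0 t1 alpha beta a b L x)
    (hL : C1xy_near L (graph_caputo t0 t1 alpha x)) :
  forall t, corner_points t0 t1 alpha x t ->
    grad_y L t (x t) (lim (caputo t0 t1 alpha x @ t^'-)) =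
    grad_y L t (x t) (lim (caputo t0 t1 alpha x @ t^'+)).
Proof.
move=> t tA; case: hx => [xmin|/weak_local_maxN xmin].
  exact: (erdmann_min ht halpha hbeta xmin hL tA).
have := erdmann_min ht halpha hbeta xmin (C1xy_nearN hL) tA.
(* At a corner both one-sided limit points lie in the graph, so L_y exists there and the minus sign
   can be pulled out. *)
have [U [_ GU UL]] := hL.
have [_ gl _ _ _] : _ := UL t (x t) (lim (caputo t0 t1 alpha x @ t^'-))
  (GU _ (or_intror (or_introl (ex_intro2 _ _ t tA erefl)))).
have [_ gr _ _ _] : _ := UL t (x t) (lim (caputo t0 t1 alpha x @ t^'+))
  (GU _ (or_intror (or_intror (ex_intro2 _ _ t tA erefl)))).
rewrite /grad_y; have [_ ->] := gradientN gl; have [_ ->] := gradientN gr.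
exact: oppr_inj.
Qed.
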